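(* Let $\lambda \ge \omega_2$ be a regular cardinal with $2^\omega = \lambda$, let $\eta < \omega_3$ be an ordinal, and assume there is a $\langle \lambda\rangle_{\omega_2}$-skeleton. Then every sequence $f = \langle \kappa_\alpha : \alpha < \eta\rangle$ of infinite cardinals with $\kappa_\alpha \le \lambda$ for all $\alpha < \eta$ and $\kappa_\alpha = \omega$ whenever $\mathrm{cf}(\alpha) = \omega_2$ is the cardinal sequence of some LCS space.
   Context: An LCS space is a locally compact, Hausdorff, scattered topological space; $I_\alpha(X)$ is the set of isolated points of $X\setminus\bigcup_{\beta<\alpha} I_\beta(X)$, $\mathrm{ht}^-(X)$ is the least $\delta$ with $I_\delta(X)$ finite, and $\mathrm{CS}(X) = \langle |I_\alpha(X)| : \alpha < \mathrm{ht}^-(X)\rangle$. For a cardinal $\kappa$ and ordinal $\alpha$, $\langle\kappa\rangle_\alpha$ denotes the constant sequence of length $\alpha$ with value $\kappa$. For $s = \langle \alpha,\zeta\rangle$ write $\pi(s)=\alpha$, $\rho(s)=\zeta$. An LCS poset is a triple $\mathcal T = \langle T,\preceq,i\rangle$ such that: (1) $\langle T,\preceq\rangle$ is a partial order with $T = \bigcup\{T_\alpha : \alpha<\eta\}$ for some nonzero ordinal $\eta$, where each $T_\alpha = \{\alpha\}\times A_\alpha$ with $A_\alpha$ a nonempty set of ordinals; (2) $s \prec t$ implies $\pi(s) < \pi(t)$; (3) if $\alpha<\beta<\eta$ and $t \in T_\beta$ then $\{s \in T_\alpha : s \prec t\}$ is infinite; (4) $i : [T]^2 \to [T]^{<\omega}$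 satisfies, for every $\{s,t\}\in[T]^2$: (a) every $v \in i\{s,t\}$ satisfies $v \preceq s$ and $v\preceq t$; (b) if $u \preceq s$ and $u \preceq t$ then $u \preceq v$ for some $v \in i\{s,t\}$. Its cardinal sequence is $\langle |T_\alpha| : \alpha<\eta\rangle$. For a sequence of cardinals $f$, an $f$-skeleton is an LCS poset $\mathcal T = \langle T,\preceq,i\rangle$ with $T = \bigcup\{\{\alpha\}\times A_\alpha : \alpha<\eta\}$ whose cardinal sequence is $f$, such that for every $\alpha<\eta$ there is a countable $O_\alpha \in [A_\alpha]^\omega$ with: $s\prec t$ and $\pi(s)=\alpha$ imply $\rho(s)\in O_\alpha$; (i) if $s,t\in\{\alpha\}\times O_\alpha$ with $\rho(s)\neq\rho(t)$ then $i\{s,t\}=\emptyset$; (ii) if $\alpha+1<\eta$, $t \in \{\alpha+1\}\times A_{\alpha+1}$ and $s\prec t$, then there is $u \in \{\alpha\}\times O_\alpha$ with $s\preceq u\prec t$. *)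

(* Defs.v *)
From HB Require Import structures.
From mathcomp Require Import all_boot.
From mathcomp Require Import boolp classical_sets cardinality topology.
Set Implicit Arguments. Unset Strict Implicit. Unset Printing Implicit Defensive.
Local Open Scope classical_set_scope.

(* ---------- well-orders (ordinals are represented by well-ordered types) *)
Definition wellorder (T : Type) (lt : T -> T -> Prop) : Prop :=
  (forall x, ~ lt x x) /\
  (forall x y z, lt x y -> lt y z -> lt x z) /\
  (forall x y, x <> y -> lt x y \/ lt y x) /\
  well_founded lt.

Definition inj_le (A B : Type) : Prop := exists f : A -> B, injective f.
Definition card_lt (A B : Type) : Prop := inj_le A B /\ ~ inj_le B A.
Definition equipotent (A B : Type) : Prop := exists f : A -> B, bijective f.
Definition infinite_type (A : Type) : Prop := ~ finite_set [set: A].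

(* |T| <= aleph_1 : T carries a well-order all of whose proper initial
   segments are countable (i.e. of order type <= omega_1). *)
Definition le_aleph1 (T : Type) : Prop :=
  exists lt : T -> T -> Prop, wellorder lt /\
    forall x, countable [set y | lt y x].

(* |T| <= aleph_2 : T carries a well-order all of whose proper initial
   segments have size <= aleph_1 (i.e. of order type <= omega_2). *)
Definition le_aleph2 (T : Type) : Prop :=
  exists lt : T -> T -> Prop, wellorder lt /\
    forall x, le_aleph1 {y : T | lt y x}.

Definition ordertype_omega2 (W : Type) (lt : W -> W -> Prop) : Prop :=
  wellorder lt /\ (forall x, le_aleph1 {y : W | lt y x}) /\ ~ le_aleph1 W.

Definition cofinal_below (I : Type) (lt : I -> I -> Prop) (a : I) (C : set I) :=
  (forall c, C c -> lt c a) /\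
  (forall b, lt b a -> exists2 c, C c & (b = c \/ lt b c)).

Definition cf_omega2 (I : Type) (lt : I -> I -> Prop) (a : I) : Prop :=
  (exists C : set I, cofinal_below lt a C /\ le_aleph2 {x : I | C x}) /\
  (forall C : set I, cofinal_below lt a C -> ~ le_aleph1 {x : I | C x}).

Definition regular_card (L : Type) : Prop :=
  forall (J : Type) (A : J -> set L),
    card_lt J L -> (forall j, card_lt {x : L | A j x} L) ->
    exists x : L, forall j, ~ A j x.

(* The LCS poset T = U_{a<eta} T_a is given by a level map pi : T -> W, where
   (W, ltW) is the index ordinal eta; T_a = pi^-1(a).  le is the partial
   order \preceq, and i s t is the finite set i{s,t} (for s <> t). *)
Definition LCS_poset (W : Type) (ltW : W -> W -> Prop) (T : Type)
  (pi : T -> W) (le : T -> T -> Prop) (i : T -> T -> set T) : Prop :=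
  let lt s t := le s t /\ s <> t in
  (forall s, le s s) /\
  (forall s t, le s t -> le t s -> s = t) /\
  (forall s t u, le s t -> le t u -> le s u) /\
  (forall a : W, exists t, pi t = a) /\
  (forall s t, lt s t -> ltW (pi s) (pi t)) /\
  (forall (a : W) (t : T), ltW a (pi t) ->
     ~ finite_set [set s | pi s = a /\ lt s t]) /\
  (forall s t, s <> t -> i s t = i t s) /\
  (forall s t, s <> t -> finite_set (i s t)) /\
  (forall s t, s <> t -> forall v, i s t v -> le v s /\ le v t) /\
  (forall s t, s <> t -> forall u, le u s -> le u t ->
     exists2 v, i s t v & le u v).

Definition succ_of (W : Type) (ltW : W -> W -> Prop) (a b : W) : Prop :=
  ltW a b /\ forall c, ltW a c -> ~ ltW c b.

(* (T, le, i) with levels pi is an f-skeleton where f = <|T_a| : a in W>,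
   O a being the countable set O_a (identified with {a} x O_a). *)
Definition skeleton (W : Type) (ltW : W -> W -> Prop) (T : Type)
  (pi : T -> W) (le : T -> T -> Prop) (i : T -> T -> set T)
  (O : W -> set T) : Prop :=
  let lt s t := le s t /\ s <> t in
  LCS_poset ltW pi le i /\
  (forall a, O a `<=` [set t | pi t = a]) /\
  (forall a, countable (O a) /\ ~ finite_set (O a)) /\
  (forall s t, lt s t -> O (pi s) s) /\
  (forall a s t, O a s -> O a t -> s <> t -> i s t = set0) /\
  (forall a b s t, succ_of ltW a b -> pi t = b -> lt s t ->
     exists2 u, O a u & le s u /\ lt u t).

Definition has_const_omega2_skeleton (L : Type) : Prop :=
  exists (W : Type) (ltW : W -> W -> Prop) (T : Type) (pi : T -> W)
    (le : T -> T -> Prop) (i : T -> T -> set T) (O : W -> set T),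
    ordertype_omega2 ltW /\
    (forall a, equipotent {t : T | pi t = a} L) /\
    skeleton ltW pi le i O.

Definition isolated_in (X : topologicalType) (Y : set X) (x : X) : Prop :=
  Y x /\ exists U : set X, open U /\ U `&` Y = [set x].

Definition LCS_space (X : topologicalType) : Prop :=
  hausdorff_space X /\
  (forall x : X, exists K : set X, compact K /\ nbhs x K) /\
  (forall Y : set X, Y !=set0 -> exists x, isolated_in Y x).

Definition CB_levels (X : topologicalType) (I : Type) (ltI : I -> I -> Prop)
  (Lev : I -> set X) : Prop :=
  forall a, Lev a = isolated_in (~` \bigcup_(b in [set b | ltI b a]) Lev b).

(* CS(X) = <|K a| : a in (I, ltI)>: the levels I_a(X), a < eta, have
   cardinalities K a and I_eta(X) is finite (the sizes K a being infinite,
   this says ht^-(X) = eta). *)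
Definition cardinal_sequence_is (X : topologicalType) (I : Type)
  (ltI : I -> I -> Prop) (K : I -> Type) : Prop :=
  exists Lev : I -> set X,
    CB_levels ltI Lev /\
    finite_set (isolated_in (~` \bigcup_(b in [set: I]) Lev b)) /\
    (forall a, equipotent {x : X | Lev a x} (K a)).

(* Main.v *)
(* Everything is reduced to one kind of object: a graded LCS poset whose
   levels are the ordinals of an interval [a, b], in which every point that is
   not maximal belongs to a countable "core" of its level, and which moreover has
   lambda many maximal points outside the core at each level of cofinality
   different from omega_2 above a.  Any sequence f as in the theorem is obtained
   from such a poset by throwing away maximal points, and an LCS poset is turned
   into an LCS space by making all the sets {u | u <= x} clopen.

   The posets are built by induction on b.  Choose a continuous increasing
   sequence eta from a cofinal in b, of length theta <= omega_2, where
   theta < omega_2 unless cf(b) = omega_2.  Stretch the skeleton T, moving its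
   level v to level eta_v: below a point t of O_(v+1) the skeleton is the
   disjoint union of the cones of countably many points u_n of O_v, so that the
   inductively given poset for [eta_v, eta_(v+1)] can be inserted between the
   u_n, which become its bottom level, and t.  Only the core is inserted below
   such t, since the points under t are not maximal any more; the maximal points
   of the levels in between come from a full copy of the poset, inserted in place
   of one point of T_(v+1) outside O_(v+1).  At a limit v the points of T_v
   outside O_v supply the maximal points of level eta_v.  If cf(b) = omega_2, all
   of T is used and level b is added by one-point compactifications of copies of
   the core. *)
Require Import Defs.
From Stdlib Require Import Inverse_Image.
From HB Require Import structures.
From mathcomp Require Import all_boot.
From mathcomp Require Import boolp classical_sets functions cardinality topology.
Set Implicit Arguments. Unset Strict Implicit. Unset Printing Implicit Defensive.
Local Open Scope classical_set_scope.

(** * Well-orders and cardinalities *)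

Section WellOrder.
Context {J : Type} {lt : J -> J -> Prop} (wo : wellorder lt).

Lemma wo_irr x : ~ lt x x.
Proof. by case: wo => + _; apply. Qed.

Lemma wo_trans x y z : lt x y -> lt y z -> lt x z.
Proof. by case: wo => _ [+ _]; apply. Qed.

Lemma wo_total x y : [\/ lt x y, x = y | lt y x].
Proof.
have [->|xy] := pselect (x = y); first by apply: Or32.
by case: wo => _ [_ [/(_ x y xy)[xy'|yx] _]]; [apply: Or31|apply: Or33].
Qed.

Lemma wo_ind : well_founded lt.
Proof. by case: wo => _ [_ []]. Qed.

Lemma wo_least (P : J -> Prop) : (exists x, P x) ->
  exists x, P x /\ forall y, P y -> ~ lt y x.
Proof.
case=> x; elim/(well_founded_ind wo_ind): x => x IH Px.
have [[y [Py yx]]|n] := pselect (exists y, P y /\ lt y x); first exact: IH Py.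
by exists x; split=> // y Py yx; apply: n; exists y.
Qed.

Lemma wo_asym x y : lt x y -> ~ lt y x.
Proof. by move=> xy /(wo_trans xy); apply: wo_irr. Qed.

(* [~ lt y x] stands for [x <= y]. *)
Lemma nlt_lt_trans x y z : ~ lt y x -> lt y z -> lt x z.
Proof. by case: (wo_total x y) => [xy _|-> _|]//; apply: wo_trans. Qed.

Lemma lt_nlt_trans x y z : lt x y -> ~ lt z y -> lt x z.
Proof. by case: (wo_total y z) => [yz xy _|-> |]//; apply: wo_trans yz. Qed.

Lemma nlt_trans x y z : ~ lt y x -> ~ lt z y -> ~ lt z x.
Proof. by move=> yx zy zx; apply: yx; apply: nlt_lt_trans zx. Qed.

Lemma nlt_eqVlt x y : ~ lt y x -> x = y \/ lt x y.
Proof. by case: (wo_total x y); auto. Qed.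

End WellOrder.

(** Recursion along [lt] where the value at [w] is only constrained by a property relative to the
    earlier values; a choice of solutions makes it an ordinary fixed point. *)
Lemma wf_choice (W B : Type) (lt : W -> W -> Prop) (wf : well_founded lt)
    (P : forall w, (forall v, lt v w -> B) -> B -> Prop) :
  (forall w r, exists x, P w r x) ->
  exists h : W -> B, forall w, P w (fun v _ => h v) (h w).
Proof.
move=> exP.
pose G w (r : forall v, lt v w -> B) := sval (cid (exP w r)).
exists (Fix wf _ G) => w; rewrite Fix_eq; first exact: svalP (cid _).
move=> v r r' rr'; congr G; apply: functional_extensionality_dep => u.
by apply: functional_extensionality_dep => uv.
Qed.

Lemma wellorder_inj (A B : Type) (f : A -> B) (lt : B -> B -> Prop) :
  injective f -> wellorder lt -> wellorder (fun x y => lt (f x) (f y)).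
Proof.
move=> fI [irr [tr [tot wf]]]; split=> [x|]; first exact: irr.
split=> [x y z|]; first exact: tr.
split=> [x y xy|]; first by apply: tot => /fI.
exact: wf_inverse_image wf.
Qed.

Lemma sig_inj (A : Type) (P : A -> Prop) (x y : {a | P a}) :
  sval x = sval y -> x = y.
Proof. exact: eq_sig_hprop (fun _ => @Prop_irrelevance _) _ _. Qed.

Lemma le_aleph1_inj (A B : Type) (f : A -> B) :
  injective f -> le_aleph1 B -> le_aleph1 A.
Proof.
move=> fI [lt [wo cnt]]; exists (fun x y => lt (f x) (f y)).
split=> [|x]; first exact: wellorder_inj.
have /countable_injP[g gI] := cnt (f x).
apply/countable_injP; exists (g \o f) => y z; rewrite !inE => yx zx gyz.
by apply: fI; apply: gI; rewrite ?inE.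
Qed.

Lemma le_aleph2_inj (A B : Type) (f : A -> B) :
  injective f -> le_aleph2 B -> le_aleph2 A.
Proof.
move=> fI [lt [wo seg]]; exists (fun x y => lt (f x) (f y)).
split=> [|x]; first exact: wellorder_inj.
pose F (y : {y | lt (f y) (f x)}) : {z | lt z (f x)} :=
  exist _ (f (sval y)) (svalP y).
by apply: (le_aleph1_inj (f := F)) => // y z [/fI/sig_inj].
Qed.

Lemma le_aleph1_nat : le_aleph1 nat.
Proof.
exists (fun m n => m < n); split=> [|n]; last exact: countableP.
split=> [n|]; first by rewrite ltnn.
split=> [m n p|]; first exact: ltn_trans.
split=> [m n /eqP|]; first by rewrite neq_ltn => /orP.
by move=> n; elim/ltn_ind: n => n IH; split=> m mn; apply: IH.
Qed.

Lemma le_aleph1W (A : Type) : le_aleph1 A -> le_aleph2 A.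
Proof.
move=> [lt [wo cnt]]; exists lt; split=> // x.
have /countable_injP[g gI] := cnt x.
apply: (le_aleph1_inj (f := fun y : {y | lt y x} => g (sval y)) _ le_aleph1_nat).
by move=> y z gyz; apply: sig_inj; apply: gI gyz; rewrite inE; apply: svalP.
Qed.

(** [None] goes to the bottom: every proper segment then gains at most one element and stays
    countable, whereas the segment below a new top could be uncountable. *)
Lemma le_aleph1_option (A : Type) : le_aleph1 A -> le_aleph1 (option A).
Proof.
move=> [lt [wo cnt]].
pose lto (x y : option A) := if y is Some b then
  if x is Some a then lt a b else True else False.
exists lto; split=> [|x].
  split; first by case=> [x|//]; apply: (wo_irr wo).
  split; first by move=> [x|] [y|] [z|] //; apply: (wo_trans wo).
  split.
    case=> [x|] [y|] //= xy; last 2 first; [by right|by left|].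
    by case: (wo_total wo x y) => [?|e|?]; [left|case: xy; rewrite e|right].
  have accN : Acc lto None by split=> y [].
  case=> [x|]; last exact: accN.
  elim/(well_founded_ind (wo_ind wo)): x => x IH.
  by split=> -[y|_]; [exact: IH|exact: accN].
case: x => [x|]; last first.
  by rewrite (_ : [set y | _] = set0); [exact: countable0|apply/seteqP; split=> y []].
have /countable_injP[g gI] := cnt x.
apply/countable_injP; exists (fun y => if y is Some y then (g y).+1 else 0).
by move=> [y|] [z|] //; rewrite !inE => yx zx [/gI->]; rewrite ?inE.
Qed.

(** * Continuous sequences of length at most omega_2 *)

Section Ladder.
Context {W : Type} {ltW : W -> W -> Prop} (oW : ordertype_omega2 ltW).
Let woW : wellorder ltW. Proof. by case: oW. Qed.

(** If [w] were a maximum, [W] would be a segment of size at most aleph_1 together with one more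
    point. *)
Lemma omega2_nomax (w : W) : exists v, ltW w v.
Proof.
apply: contrapT => nv; case: oW => _ [/(_ w) wa]; apply.
pose f x : option {y | ltW y w} :=
  if pselect (ltW x w) is left xw then Some (exist _ x xw) else None.
apply: (le_aleph1_inj (f := f)); last exact: le_aleph1_option.
have fN x : f x = None -> x = w.
  rewrite /f; case: pselect => // nxw _; case: (wo_total woW x w) => // wx.
  by case: nv; exists x.
move=> x y; case fx: (f x) => [u|]; last by move=> /esym/fN->; exact: fN fx.
move=> /esym fy; move: fx fy; rewrite /f.
by case: pselect => // xw [<-]; case: pselect => // yw [].
Qed.

(* Enumerating [C] along [W], always taking the least element not yet listed,
   exhausts [C]: otherwise [W] would embed in a proper initial segment. *)
Lemma omega2_enum (C : Type) (c0 : C) : le_aleph2 C ->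
  exists g : W -> C, (forall c, exists w, g w = c) /\
    (le_aleph1 C -> exists w0, forall c, exists2 v, ltW v w0 & g v = c).
Proof.
move=> [lt [wo seg]].
pose P w (r : forall v, ltW v w -> option C) (o : option C) :=
  if o is Some c then (forall v h, r v h <> Some c) /\
    forall d, (forall v h, r v h <> Some d) -> ~ lt d c
  else forall c, exists v h, r v h = Some c.
have [w r|h hP] := wf_choice (wo_ind woW) (P := P).
  have [e|ne] := pselect (exists c, forall v h, r v h <> Some c).
    by have [c [? ?]] := wo_least wo e; exists (Some c).
  exists None => c; apply: contrapT => nc; apply: ne; exists c => v hv rv.
  by apply: nc; exists v, hv.
have hlt v w c : ltW v w -> h v = Some c -> h w <> Some c.
  move=> vw hv hw; move: (hP w); rewrite hw => -[/(_ v vw)].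
  by rewrite hv.
have hI v w : h v <> None -> h v = h w -> v = w.
  case hv: (h v) => [c|] // _ /esym hw.
  case: (wo_total woW v w) => // [/hlt|/hlt] H.
    by case: (H _ hv hw).
  by case: (H _ hw hv).
exists (fun w => odflt c0 (h w)); split=> [c|C1].
  apply: contrapT => nc.
  have hc w : h w <> Some c by move=> hw; apply: nc; exists w; rewrite hw.
  have hs w : exists d, h w = Some d /\ lt d c.
    move: (hP w); case hw: (h w) => [d|] /=; last first.
      by move=> /(_ c)[v [_ /hc]].
    move=> [_ /(_ c (fun v _ => @hc v)) ncd]; exists d; split=> //.
    by case: (wo_total wo d c) => // dc; case: (hc w); rewrite hw dc.
  case: oW => _ [_]; apply; have /choice[f hf] := hs.
  apply: (le_aleph1_inj (f := fun w => exist _ (f w) (proj2 (hf w)) : {d | lt d c})) => //.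
  move=> v w [fvw]; apply: hI; first by case: (hf v) => ->.
  by case: (hf v) => -> _; case: (hf w) => -> _; rewrite fvw.
(* If the enumeration never stops, it injects [W] into [C], which has size at most aleph_1. *)
have [[w0 hw0]|n] := pselect (exists w0, h w0 = None).
  exists w0 => c; move: (hP w0); rewrite hw0 => /(_ c)[v [vw hv]].
  by exists v => //; rewrite hv.
case: oW => _ [_ []].
apply: (le_aleph1_inj (f := fun w => odflt c0 (h w))) => // v w.
case hv: (h v) => [c|]; last by case: n; exists v.
case hw: (h w) => [d|]; last by case: n; exists w.
by move=> /= cd; apply: hI; rewrite hv// hw cd.
Qed.

Context {J : Type} {lt : J -> J -> Prop} (wo : wellorder lt).

(** Under [N] a cofinal set of size at most aleph_1 is enumerated, and the enumeration is exhausted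
    before some [w0]. Otherwise the whole segment below [b] is enumerated. *)
Lemma cofinal_enum (b : J) (N : Prop) : (exists a, lt a b) ->
  le_aleph2 {x | lt x b} ->
  (N -> exists C : set J, cofinal_below lt b C /\ le_aleph1 {x : J | C x}) ->
  exists g : W -> J, [/\ forall w, lt (g w) b,
    forall x, lt x b -> exists w, ~ lt (g w) x &
    N -> exists w0, forall x, lt x b -> exists2 w, ltW w w0 & ~ lt (g w) x].
Proof.
move=> [a ab] le2 hN; have [/[dup] Nb /hN[C [[Cb Ccof] C1]]|nN] := pselect N.
  have [c Cc _] := Ccof a ab.
  have [g [gs /(_ C1)[w0 g0]]] := omega2_enum (exist C c Cc) (le_aleph1W C1).
  have H x : lt x b -> exists2 w, ltW w w0 & ~ lt (sval (g w)) x.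
    move=> /Ccof[d Cd xd]; have [w ww gw] := g0 (exist C d Cd).
    exists w; rewrite // gw /=; case: xd => [->|]; first exact: (wo_irr wo).
    exact: (wo_asym wo).
  exists (fun w => sval (g w)); split=> [w|x /H[w _ ?]|_]; last by exists w0.
    exact: Cb (svalP (g w)).
  by exists w.
have [g [gs _]] := omega2_enum (exist _ a ab : {x | lt x b}) le2.
exists (fun w => sval (g w)); split=> [w|x xb|//]; first exact: svalP (g w).
by have [w gw] := gs (exist _ x xb); exists w; rewrite gw /=; exact: (wo_irr wo).
Qed.

(** At a limit [w] the demand of passing [g v] is already met by [eta u] for any [u] between [v] and
    [w], whence continuity. Under [N] the values [g v] with [v] before some [w0] are cofinal in [b],
    so every value of [eta] after [w0] must be [b]. *)
Lemma ladder_exists (a b : J) (N : Prop) : lt a b ->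
  le_aleph2 {x | lt x b} ->
  (N -> exists C : set J, cofinal_below lt b C /\ le_aleph1 {x : J | C x}) ->
  exists eta : W -> J,
    [/\ forall w, ~ lt (eta w) a /\ ~ lt b (eta w),
        forall v w, ltW v w -> lt (eta v) (eta w) \/ eta w = b,
        forall w x, ~ lt x a -> (forall v, ~ succ_of ltW v w) ->
          (forall v, ltW v w -> lt (eta v) x) -> ~ lt x (eta w),
        forall v w, succ_of ltW v w -> lt (eta v) b -> eta w = b ->
          succ_of lt (eta v) b &
        (exists w, eta w = b) \/
        ~ N /\ forall x, lt x b -> exists w, lt x (eta w)].
Proof.
move=> ab le2 hN.
have [g [gb gcof gN]] := cofinal_enum (ex_intro _ a ab) le2 hN.
(* [eta w] is the least point of [a, b] above all [eta v] and [g v], [v < w], and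
   [b] if there is none below [b]. *)
pose Q w (r : forall v, ltW v w -> J) x := ~ lt x a /\
  (~ lt x b \/ forall v h, lt (r v h) x /\ ~ lt x (g v)).
have [w r|eta heta] := wf_choice (wo_ind woW)
    (P := fun w r x => Q w r x /\ forall y, Q w r y -> ~ lt y x).
  apply: (wo_least wo); exists b; split; first exact: (wo_asym wo ab).
  by left; apply: (wo_irr wo).
have ea w : ~ lt (eta w) a by case: (heta w) => -[].
have eb w : ~ lt b (eta w).
  case: (heta w) => _; apply; split; first exact: (wo_asym wo ab).
  by left; apply: (wo_irr wo).
have ebE w : ~ lt (eta w) b -> eta w = b.
  by move=> /(nlt_eqVlt wo)[//|/eb].
have emono v w : ltW v w -> lt (eta v) (eta w) \/ eta w = b.
  move=> vw; case: (heta w) => -[_ [/ebE|/(_ v vw)[]]]; by [right|left].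
have eg v w : ltW v w -> lt (eta w) b -> ~ lt (eta w) (g v).
  by move=> vw wb; case: (heta w) => -[_ [//|/(_ v vw)[]]].
exists eta; split=> //.
- move=> w x xa nsucc wx xw; case: (heta w) => _ /(_ x); apply=> //.
  split=> //; right=> v vw; split; first exact: wx.
  have [u [vu uw]] : exists u, ltW v u /\ ltW u w.
    by apply: contrapT => nu; apply: (nsucc v); split=> // u vu uw; apply: nu; exists u.
  have xb := lt_nlt_trans wo xw (@eb w).
  have ub := wo_trans wo (wx u uw) xb.
  have := @eg _ _ vu ub; have := wx u uw => ux nug xg.
  exact: nug (wo_trans wo ux xg).
- move=> v w [vw nsucc] vb wb; split=> // x vx xb.
  (* [y] is the larger of [x] and [g v]; being below [b], it would be a smaller admissible value for
     [eta w]. *)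
  have [y [yb ny]] : exists y, lt y b /\ (~ lt y x /\ ~ lt y (g v)).
    have [xg|] := pselect (lt x (g v)); last first.
      by exists x; split=> //; split=> //; exact: (wo_irr wo).
    by exists (g v); split=> //; split; [exact: (wo_asym wo xg)|exact: (wo_irr wo)].
  case: (heta w) => _ /(_ y); rewrite wb; apply=> //.
  case: ny => nyx nyg; have vy := lt_nlt_trans wo vx nyx.
  split; first by move=> ya; exact: (@ea v) (wo_trans wo vy ya).
  right=> u uw; have [->|uv] : u = v \/ ltW u v.
  + by case: (wo_total woW u v) => [||/nsucc//]; auto.
  + by split.
  + have [uv'|e] := emono _ _ uv; last by case: (wo_irr wo (x := b)); rewrite -{1}e.
    split; first exact: (wo_trans wo uv' vy).
    by move=> yg; apply: (@eg _ _ uv vb); exact: (wo_trans wo vy yg).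
- have [|ne] := pselect (exists w, eta w = b); [by left|right].
  have eltb w : lt (eta w) b by apply: contrapT => /ebE ?; apply: ne; exists w.
  split=> [/gN[w0 hw0]|x xb].
    have [w1 w01] := omega2_nomax w0.
    have [v vw0 nv] := hw0 _ (eltb w1).
    have [w01'|e] := emono _ _ w01; last by apply: ne; exists w1.
    apply: (@eg _ _ vw0 (eltb w0)); exact: (lt_nlt_trans wo w01' nv).
  have [w nw] := gcof x xb; have [w1 ww1] := omega2_nomax w.
  have [w2 w12] := omega2_nomax w1.
  have [w12'|e] := emono _ _ w12; last by case: ne; exists w2.
  exists w2; apply: (nlt_lt_trans wo) w12'.
  by exact: (nlt_trans wo nw (@eg _ _ ww1 (eltb w1))).
Qed.

End Ladder.

(** * Countable sets, infinite sets and the continuum *)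

Lemma countable_inj (T : Type) (C : countType) (A : set T) (f : T -> C) :
  (forall x y, A x -> A y -> f x = f y -> x = y) -> countable A.
Proof.
move=> fI; apply/countable_injP; exists (choice.pickle \o f) => x y.
by rewrite !inE => Ax Ay /(pcan_inj choice.pickleK); apply: fI.
Qed.

Lemma countable_code (T : Type) (A : set T) : countable A ->
  exists c : T -> nat, forall x y, A x -> A y -> c x = c y -> x = y.
Proof.
by move=> /countable_injP[c cI]; exists c => x y Ax Ay; apply: cI; rewrite inE.
Qed.

Lemma infinite_image_inj (T U : Type) (A : set T) (B : set U) (f : T -> U) :
  (forall x y, A x -> A y -> f x = f y -> x = y) -> (forall x, A x -> B (f x)) ->
  infinite_set A -> infinite_set B.
Proof.
move=> fI fAB infA finB; apply: infA.
have fin : finite_set (f @` A).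
  by apply: sub_finite_set finB => _ [x Ax <-]; apply: fAB.
rewrite -(@eq_finite_set _ _ (f @` A) A)//; apply: inj_card_eq => x y.
by rewrite !inE; apply: fI.
Qed.

Lemma infinite_range (U : Type) (B : set U) (f : nat -> U) :
  injective f -> (forall n, B (f n)) -> infinite_set B.
Proof.
by move=> fI fB; apply: (infinite_image_inj (f := f)) infinite_nat => // x y _ _ /fI.
Qed.

Lemma infinite_enum (T : Type) (A : set T) : infinite_set A ->
  exists2 f : nat -> T, injective f & forall n, A (f n).
Proof.
move=> /infiniteP/card_leP[f]; pose in0 n : [set: nat] := exist _ n (mem_set I).
exists (fun n => set_val (f (in0 n))) => [m n /val_inj fmn|n].
  by have [] : in0 m = in0 n by apply: (@inj _ _ _ f) fmn; rewrite inE.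
exact: set_valP.
Qed.

Lemma countable_enum (T : Type) (A : set T) : countable A -> infinite_set A ->
  exists f : nat -> T, [/\ injective f, forall n, A (f n) &
    forall x, A x -> exists n, f n = x].
Proof.
move=> cA /(eq_card_nat cA)/card_esym/card_bijP[f [g fK gK]].
pose in0 n : [set: nat] := exist _ n (mem_set I).
exists (fun n => set_val (f (in0 n))); split=> [m n|n|x Ax].
- by move=> /val_inj/(can_inj fK)[].
- exact: set_valP.
- pose y : A := exist _ x (mem_set Ax); exists (set_val (g y)).
  rewrite (_ : in0 _ = g y) ?gK//; exact: val_inj.
Qed.

Lemma cantor_nat (k : (nat -> bool) -> nat) : ~ injective k.
Proof.
move=> kI; pose d n := `[< exists2 x, k x = n & x n = false >].
have [dk|] := boolP (d (k d)).
  by move: (dk) => /asboolP[x /kI->]; rewrite dk.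
by move=> dk; move: (dk) => /asboolPn[]; exists d => //; apply: negbTE.
Qed.

(* Splitting [nat -> bool] into continuum many columns of size continuum, a
   countable set misses one of the columns. *)
Lemma continuum_diff (T L : Type) (P O : set T) : equipotent (nat -> bool) L ->
  equipotent {t | P t} L -> countable O ->
  exists g : L -> T, injective g /\ forall x, P (g x) /\ ~ O (g x).
Proof.
move=> [c [c' cK c'K]] [f [f' fK f'K]] /countable_code[k kI].
pose j (x y : nat -> bool) n := if odd n then x n./2 else y n./2.
have jIl x x' y y' : j x y = j x' y' -> x = x'.
  move=> e; apply: funext => n.
  by have := congr1 (@^~ n.*2.+1) e; rewrite /j /= odd_double /= uphalf_double.
have jIr x x' y y' : j x y = j x' y' -> y = y'.
  move=> e; apply: funext => n.
  by have := congr1 (@^~ n.*2) e; rewrite /j odd_double doubleK.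
pose e x := sval (f' (c x)).
have eI : injective e.
  by move=> x y /sig_inj/(can_inj f'K)/(can_inj cK).
have [x hx] : exists x, forall y, ~ O (e (j x y)).
  apply: contrapT => nx.
  have /choice[y hy] : forall x, exists y, O (e (j x y)).
    by move=> x; apply: contrapT => ny; apply: nx; exists x => y Oy; apply: ny; exists y.
  by apply: (@cantor_nat (fun x => k (e (j x (y x))))) => x x' /kI/eI/jIl; apply.
exists (fun l => e (j x (c' l))); split=> [l l' /eI/jIr/(can_inj c'K)//|l].
by split; [exact: svalP (f' _)|exact: hx].
Qed.

Lemma equipotent_antisym (A B : Type) (f : A -> B) (g : B -> A) :
  injective f -> injective g -> equipotent A B.
Proof.
move=> fI gI.
have le (U V : Type) (h : U -> V) : injective h -> ([set: U] #<= [set: V])%card.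
  move=> hI; rewrite -(card_le_eql (inj_card_eq (A := setT) (f := h) _)).
    exact: subset_card_le.
  by move=> x y _ _ /hI.
have /card_bijP[h [k hK kK]] := Cantor_Bernstein (le _ _ f fI) (le _ _ g gI).
pose inT (U : Type) (x : U) : [set: U] := exist _ x (mem_set I).
exists (fun x => set_val (h (inT A x))); exists (fun y => set_val (k (inT B y))) => x.
- by rewrite (_ : inT B _ = h (inT A x)) ?hK//; apply: val_inj.
- by rewrite (_ : inT A _ = k (inT B x)) ?kK//; apply: val_inj.
Qed.

(** Hilbert's hotel: on a copy [h] of the naturals in [K], the point [h n] moves to [h n.*2.+1],
    which frees the even places for the summand [nat]. The map [r] inverts [h] on its range. *)
Lemma sum_nat_inj (K : Type) : infinite_type K ->
  exists f : nat + K -> K, injective f.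
Proof.
move=> /infinite_enum[h hI _].
have /choice[r hr] : forall k, exists n, (exists m, h m = k) -> h n = k.
  move=> k; have [[m hm]|n] := pselect (exists m, h m = k); first by exists m.
  by exists 0 => /n.
pose f (x : nat + K) := match x with
  | inl n => h n.*2
  | inr k => if pselect (exists m, h m = k) is left _ then h (r k).*2.+1 else k end.
have par m n : m.*2 <> n.*2.+1.
  by move=> /(congr1 odd); rewrite /= !odd_double.
exists f => -[m|k] [n|l] /=.
- by move=> /hI/double_inj->.
- case: pselect => [_ /hI/par//|nl e]; case: nl; by exists m.*2.
- case: pselect => [_ /hI/esym/par//|nk e]; case: nk; by exists n.*2.
- case: pselect => [ek|nk]; case: pselect => [el|nl].
  + by move=> /hI[/double_inj ekl]; rewrite -(hr k ek) ekl hr.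
  + by move=> e; case: nl; exists (r k).*2.+1.
  + by move=> e; case: nk; exists (r l).*2.+1.
  + by move=> ->.
Qed.

Section OptionOrder.
Context (I : Type) (lt : I -> I -> Prop) (wo : wellorder lt).

(** The new top [None] serves as the right end of an interval that contains all of [I]. *)
Definition lt_top (x y : option I) : Prop :=
  match x, y with
  | Some a, Some b => lt a b | Some _, None => True | None, _ => False end.

Lemma wellorder_top : wellorder lt_top.
Proof.
split; first by case=> [x|//]; exact: (wo_irr wo).
split; first by move=> [x|] [y|] [z|] //; exact: (wo_trans wo).
split.
  case=> [x|] [y|] //= xy; last 2 first; [by left|by right|].
  by case: (wo_total wo x y) => [?|e|?]; [left|case: xy; rewrite e|right].
have acc x : Acc lt_top (Some x).
  elim/(well_founded_ind (wo_ind wo)): x => x IH.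
  by split=> -[y|[]]; exact: IH.
case=> [x|]; first exact: acc.
by split=> -[y _|[]]; exact: acc.
Qed.

End OptionOrder.

(** * The topology of a graded poset *)

(* An LCS poset on the subset [D] of [T] (the order [le] is only defined there)
   whose set of levels is [Lv] and whose non-maximal points lie in [core]; by
   [gp_below] antisymmetry is automatic.  The finite sets i{s,t} are replaced by
   their existence. *)
Record graded_poset (J : Type) (ltJ : J -> J -> Prop) (T : Type) (lev : T -> J)
    (core D : set T) (le : T -> T -> Prop) (Lv : set J) : Prop := GradedPoset {
  gp_dom : forall x y, le x y -> D x /\ D y;
  gp_refl : forall x, D x -> le x x;
  gp_trans : forall x y z, le x y -> le y z -> le x z;
  gp_below : forall x y, le x y -> x = y \/ core x /\ ltJ (lev x) (lev y);
  gp_lev : forall x, D x -> Lv (lev x);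
  gp_inf : forall t b, D t -> Lv b -> ltJ b (lev t) ->
    infinite_set [set s | lev s = b /\ le s t];
  gp_meet : forall x y, D x -> D y -> exists F : set T,
    [/\ finite_set F, forall v, F v -> le v x /\ le v y &
        forall u, le u x -> le u y -> exists2 v, F v & le u v] }.

(** The phantom parameter [le] ties the topology to the order. *)
Definition poset_space (T : Type) (le : T -> T -> Prop) : Type := T.

Section PosetTopology.
Context (T : Type) (le : T -> T -> Prop).
Local Notation X := (poset_space le).
Local Notation down y := [set x | le x y].
Local Notation downs F := [set x | exists2 v, F v & le x v].

HB.instance Definition _ := gen_eqMixin X.
HB.instance Definition _ := gen_choiceMixin X.

(** The sets [down x] minus [downs F], with [F] finite and [x] outside [downs F], form a
    neighbourhood base at [x] for the coarsest topology in which every [down y] is clopen. *)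
Definition poset_open (A : set X) := forall x, A x ->
  exists F : set T, [/\ finite_set F, ~ downs F x & down x `\` downs F `<=` A].

Lemma poset_openT : poset_open setT.
Proof. by move=> x _; exists set0; split=> // -[]. Qed.

Lemma poset_openI (A B : set X) :
  poset_open A -> poset_open B -> poset_open (A `&` B).
Proof.
move=> oA oB x [/oA[F [finF Fx FA]] /oB[G [finG Gx GB]]].
exists (F `|` G); split; first by rewrite finite_setU.
- by case=> v [Fv|Gv] xv; [apply: Fx|apply: Gx]; exists v.
- move=> y [yx nFG]; split; [apply: FA|apply: GB]; split=> // -[v Fv yv];
  by apply: nFG; exists v => //; solve [by left|by right].
Qed.

Lemma poset_open_bigU (I : Type) (f : I -> set X) :
  (forall i, poset_open (f i)) -> poset_open (\bigcup_i f i).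
Proof.
move=> of_ x [i _ /of_[F [finF Fx FA]]]; exists F; split=> // y /FA fy.
by exists i.
Qed.

HB.instance Definition _ := isOpenTopological.Build X
  poset_openT poset_openI poset_open_bigU.

Lemma open_posetE (A : set X) : open A = poset_open A.
Proof. by []. Qed.

Context (J : Type) (ltJ : J -> J -> Prop) (wo : wellorder ltJ) (lev : T -> J).
Hypothesis gp : graded_poset ltJ lev setT setT le setT.

Let le_refl x : le x x. Proof. exact: (gp_refl gp). Qed.

Lemma open_down (x : T) : open (down x : set X).
Proof.
rewrite open_posetE => y yx; exists set0; split=> //; first by case.
by move=> z [zy _]; apply: (gp_trans gp) yx.
Qed.

Lemma open_downC (x : T) : open (~` down x : set X).
Proof.
rewrite open_posetE => y yx; exists [set x]; split=> //.
  by case=> _ -> /yx.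
by move=> z [zy nz] zx; apply: nz; exists x.
Qed.

Lemma le_antisym x y : le x y -> le y x -> x = y.
Proof.
move=> /(gp_below gp)[//|[_ xy]] /(gp_below gp)[//|[_ yx]].
by case: (wo_asym wo xy yx).
Qed.

Lemma poset_hausdorff : hausdorff_space X.
Proof.
have sep (x y : X) : ~ le x y -> exists A B : set X,
    [/\ nbhs x A, nbhs y B & A `&` B = set0].
  move=> xy; exists (~` down y), (down y); split.
  - by apply: open_nbhs_nbhs; split; [apply: open_downC|].
  - by apply: open_nbhs_nbhs; split; [apply: open_down|apply: le_refl].
  - by rewrite setICl.
move=> x y clxy; apply: contrapT => xy.
have [nxy|nyx] : ~ le x y \/ ~ le y x.
- have [xley|] := pselect (le x y); last by left.
  by right=> yx; apply: xy; apply: le_antisym.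
- have [A [B [Ax By AB]]] := sep _ _ nxy.
  by have [z] := clxy _ _ Ax By; rewrite AB.
- have [A [B [Ax By AB]]] := sep _ _ nyx.
  by have [z] := clxy _ _ By Ax; rewrite setIC AB.
Qed.

Lemma compact_bigcup_down (F : set T) : finite_set F ->
  (forall v, F v -> compact (down v : set X)) ->
  compact (\bigcup_(v in F) (down v : set X)).
Proof.
(* Retyped over [X], which carries a generic equality structure, the finite set can be listed as a
   sequence. *)
move=> finF cF; pose F' : set X := F.
have {}finF : finite_set F' by [].
have {}cF v : F' v -> compact (down v : set X) by apply: cF.
change (compact (\bigcup_(v in F') (down v : set X))).
move: F' finF cF => {}F /finite_seqP[s ->] {F}.
elim: s => [|v s IH] cF.
  by rewrite (_ : \bigcup_(_ in _) _ = set0) ?bigcup0//; apply: compact0.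
rewrite (_ : \bigcup_(_ in _) _ = down v `|` \bigcup_(w in [set` s]) down w); last first.
  apply/seteqP; split=> [x [w /=]|x].
    rewrite inE => /orP[/eqP-> |]; first by left.
    by move=> ws xw; right; exists w.
  by move=> [xv|[w ws xw]]; [exists v|exists w] => //=; rewrite ?inE ?eqxx// (ws : w \in s) orbT.
apply: compactU; first by apply: cF; rewrite /= inE eqxx.
by apply: IH => w ws; apply: cF; rewrite /= inE (ws : w \in s) orbT.
Qed.

(** Induction on the level of [x]. If [x] is not a cluster point of [G], some member of [G] misses a
    basic neighbourhood of [x], so within [down x] it lies in [downs F]. The meets of [x] with the
    elements of [F] cover that part by finitely many cones of points strictly below [x], which are
    compact by induction. *)
Lemma compact_down (x : T) : compact (down x : set X).
Proof.
suff H a : forall x, lev x = a -> compact (down x : set X) by apply: H erefl.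
elim/(well_founded_ind (wo_ind wo)): a => {x} a IH x xa G PG Gx.
apply: contrapT => ncl.
have [A [B [Ax GB AB]]] : exists A B : set X, [/\ nbhs (x : X) A, G B & A `&` B = set0].
  apply: contrapT => nAB; apply: ncl; exists x; split; first exact: le_refl.
  move=> B A GB Ax; apply/set0P/eqP => AB0; apply: nAB.
  by exists A, B; split=> //; rewrite setIC.
move: Ax; rewrite nbhsE /= => -[U [oU Ux] UA].
have [F [finF Fx FU]] : exists F : set T, [/\ finite_set F, ~ downs F x &
    down x `\` downs F `<=` U] by apply: oU.
have /choice[M hM] : forall v, exists M : set T, [/\ finite_set M,
    forall w, M w -> le w x /\ le w v &
    forall u, le u x -> le u v -> exists2 w, M w & le u w].
  by move=> v; apply: (gp_meet gp).
pose H : set T := \bigcup_(v in F) M v.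
have finH : finite_set H by apply: bigcup_finite => // v _; case: (hM v).
have cH : compact (\bigcup_(v in H) (down v : set X)).
  apply: compact_bigcup_down => // w [v Fv Mw]; apply: IH (erefl _).
  case: (hM v) => _ /(_ w Mw)[wx wv] _; case: (gp_below gp wx); last by rewrite xa => -[].
  by move=> wx'; case: Fx; exists v; rewrite // -wx'.
have GH : G (\bigcup_(v in H) (down v : set X)).
  apply: filterS (filterI Gx GB) => u [ux Bu].
  have [[v Fv uv]|nu] := pselect (downs F u); last first.
    have : (A `&` B) u by split=> //; apply: UA; apply: FU; split.
    by rewrite AB.
  case: (hM v) => _ _ /(_ u ux uv)[w Mw uw]; exists w => //.
  by exists v.
have [z [[w [v Fv Mw] zw] clz]] := cH G PG GH.
apply: ncl; exists z; split=> //.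
by apply: (gp_trans gp) zw _; case: (hM v) => _ /(_ w Mw)[].
Qed.

Lemma poset_isolated (Y : set X) (x : X) : Y x ->
  (forall y, Y y -> ~ ltJ (lev y) (lev x)) -> isolated_in Y x.
Proof.
move=> Yx minx; split=> //; exists (down x); split; first exact: open_down.
apply/seteqP; split=> [y [yx Yy]|y ->]; last by split=> //; apply: le_refl.
by case: (gp_below gp yx) => // -[_ yltx]; case: (minx y Yy).
Qed.

(** Suppose [x] lies above level [a] and take a basic neighbourhood of it, given by [F]. The meets
    of [x] with [F] are finitely many points strictly below [x], so some level [m] between [a] and
    that of [x] is not below any of theirs. Infinitely many points of level [m] lie under [x], and
    one that is not such a meet cannot be under [F]; hence [x] is not isolated. *)
Lemma poset_isolated_lev (a : J) (x : X) :
  isolated_in [set y : X | ~ ltJ (lev y) a] x <-> lev x = a.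
Proof.
split=> [[/= xa [U [oU UY]]]|xa]; last first.
  by apply: poset_isolated => /=; rewrite xa//; apply: (wo_irr wo).
have Ux : U x by have [] : (U `&` [set y : X | ~ ltJ (lev y) a]) x by rewrite UY.
have [F [finF Fx FU]] : exists F : set T, [/\ finite_set F, ~ downs F x &
    down x `\` downs F `<=` U] by apply: oU.
case: (nlt_eqVlt wo xa) => // ax; exfalso.
have /choice[M hM] : forall v, exists M : set T, [/\ finite_set M,
    forall w, M w -> le w x /\ le w v &
    forall u, le u x -> le u v -> exists2 w, M w & le u w].
  by move=> v; apply: (gp_meet gp).
pose H : set T := \bigcup_(v in F) M v.
have finH : finite_set H by apply: bigcup_finite => // v _; case: (hM v).
have Hx w : H w -> ltJ (lev w) (lev x).
  case=> v Fv Mw.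
  case: (hM v) => _ /(_ w Mw)[wx wv] _; case: (gp_below gp wx); last by case.
  by move=> wx'; case: Fx; exists v; rewrite // -wx'.
have [m [am mx mH]] : exists m, [/\ ~ ltJ m a, ltJ m (lev x) &
    forall w, H w -> ~ ltJ m (lev w)].
  pose H' : set X := H.
  have {}finH : finite_set H' by [].
  have {}Hx w : H' w -> ltJ (lev w) (lev x) by apply: Hx.
  suff : exists m, [/\ ~ ltJ m a, ltJ m (lev x) &
    forall w, H' w -> ~ ltJ m (lev w)] by [].
  move: finH Hx => /finite_seqP[s ->].
  elim: s => [|w s IH] Hx; first by exists a; split=> //; apply: (wo_irr wo).
  case: IH => [w' ws|m [am mx mH]].
    by apply: Hx; rewrite /= inE (ws : _ \in _) orbT.
  have wx : ltJ (lev w) (lev x) by apply: Hx; rewrite /= inE eqxx.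
  have [mw|mw] := pselect (ltJ m (lev w)).
    exists (lev w); split=> //; first by exact: (nlt_trans wo am (wo_asym wo mw)).
    move=> w'; rewrite /= inE => /orP[/eqP-> |/mH]; first exact: (wo_irr wo).
    by move=> mw' /(wo_trans wo mw).
  exists m; split=> // w'; rewrite /= inE => /orP[/eqP-> //|/mH]; exact.
have inf := gp_inf gp (t := x) I I mx.
have [s [sm sx] nHs] : exists2 s, lev s = m /\ le s x & ~ H s.
  apply: contrapT => n; apply: inf; apply: sub_finite_set finH => s [sm sx].
  by apply: contrapT => nHs; apply: n; exists s.
have sFx : ~ downs F s.
  case=> v Fv sv; case: (hM v) => _ hMv /(_ s sx sv)[w Mw sw].
  have Hw : H w by exists v.
  case: (gp_below gp sw) => [sw'|[_]]; first by apply: nHs; rewrite sw'.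
  by rewrite sm; apply: mH.
have : (U `&` [set y : X | ~ ltJ (lev y) a]) s by split; [apply: FU|rewrite /= sm].
rewrite UY => /= sx'; move: mx; rewrite -sm sx'; exact: (wo_irr wo).
Qed.

Lemma poset_space_LCS : LCS_space X.
Proof.
split; first exact: poset_hausdorff.
split=> [x|Y [y0 Yy0]].
  exists (down x); split; first exact: compact_down.
  by apply: open_nbhs_nbhs; split; [apply: open_down|apply: le_refl].
have [a [[x [Yx xa]] mina]] := wo_least wo (P := fun a => exists x, Y x /\ lev x = a)
  (ex_intro _ _ (ex_intro _ y0 (conj Yy0 erefl))).
exists x; apply: poset_isolated => // y Yy; rewrite xa; apply: mina.
by exists y.
Qed.

Lemma poset_space_sequence (K : J -> Type) :
  (forall a, equipotent {x : T | lev x = a} (K a)) ->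
  @cardinal_sequence_is X J ltJ K.
Proof.
move=> eK; exists (fun a => [set x : X | lev x = a]); split; last split=> //.
  move=> a; rewrite (_ : ~` _ = [set y : X | ~ ltJ (lev y) a]).
    by apply/seteqP; split=> x /poset_isolated_lev.
  apply/seteqP; split=> x /= nx; first by move=> xa; apply: nx; exists (lev x).
  by case=> b /= ba xb; apply: nx; rewrite xb.
rewrite (_ : isolated_in _ = set0)//; apply/seteqP; split=> // x [nx _].
by apply: nx; exists (lev x).
Qed.

End PosetTopology.

(** * Universal posets *)

Section UniversalPosets.
Context (L J : Type) (lt : J -> J -> Prop) (wo : wellorder lt) (N : set J).

Definition interval (a b : J) : set J := [set x | ~ lt x a /\ ~ lt b x].

(* [N] is the set of levels that must have lambda many points outside the core. *)
Record wide (T : Type) (lev : T -> J) (core D : set T) (Lv : set J) (a : J) :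
  Prop := Wide {
  wide_countable : forall b, Lv b ->
    countable [set x | [/\ D x, core x & lev x = b]];
  wide_infinite : forall b, Lv b ->
    infinite_set [set x | [/\ D x, core x & lev x = b]];
  wide_rest : forall b, Lv b -> lt a b -> N b -> exists g : L -> T,
    injective g /\ forall l, [/\ D (g l), ~ core (g l) & lev (g l) = b] }.

Local Notation V := (J * (nat + L))%type.

(* All posets of the induction live on [V]: at level [c] the core points are the
   [(c, inl n)] and the other points the [(c, inr l)]. *)
Definition std_core : set V := [set v | exists n, v.2 = inl n].
Definition std_dom (a b : J) : set V :=
  [set v | interval a b v.1 /\ (~ std_core v -> lt a v.1 /\ N v.1)].

(** The bottom level has core points only, so that it can be glued onto countably many points of a
    skeleton level. *)
Definition universal (a b : J) : Prop := exists S,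
  graded_poset lt fst std_core (std_dom a b) S (interval a b).

Lemma graded_finite_image (T U : Type) (F : set T) (f : T -> U) (x y : U) le :
  finite_set F -> (forall v, F v -> le (f v) x /\ le (f v) y) ->
  (forall u, le u x -> le u y -> exists2 v, F v & le u (f v)) ->
  exists G : set U, [/\ finite_set G, forall v, G v -> le v x /\ le v y &
        forall u, le u x -> le u y -> exists2 v, G v & le u v].
Proof.
move=> finF Fxy H; exists (f @` F); split; first exact: finite_image.
  by move=> _ [v Fv <-]; apply: Fxy.
by move=> u ux uy; have [v Fv uv] := H u ux uy; exists (f v) => //; exists v.
Qed.

(** The core of each level is enumerated, and [L] many other points are kept where [N] asks for
    them. The points dropped are outside the core, hence maximal, so the kept points lose neither
    lower bounds nor meets. *)
Lemma universal_of_wide (T : Type) (lev : T -> J) (core D : set T) le (a b : J) :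
  ~ lt b a -> graded_poset lt lev core D le (interval a b) ->
  wide lev core D (interval a b) a -> universal a b.
Proof.
move=> ab gp wd.
have [t0 _] : exists t : T, True.
  have /(wide_infinite wd)/infinite_setN0[t _] : interval a b a.
    by split; [apply: (wo_irr wo)|].
  by exists t.
have /choice[f hf] : forall c, exists f : nat -> T, interval a b c ->
    [/\ injective f, forall n, [/\ D (f n), core (f n) & lev (f n) = c] &
    forall x, [/\ D x, core x & lev x = c] -> exists n, f n = x].
  move=> c; have [ic|nic] := pselect (interval a b c); last by exists (fun=> t0).
  by have [f hf] := countable_enum (wide_countable wd ic) (wide_infinite wd ic); exists f.
have /choice[g hg] : forall c, exists g : L -> T, interval a b c -> lt a c -> N c ->
    injective g /\ forall l, [/\ D (g l), ~ core (g l) & lev (g l) = c].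
  move=> c; have [[ic [ac Nc]]|n] := pselect (interval a b c /\ lt a c /\ N c).
    by have [g hg'] := wide_rest wd ic ac Nc; exists g.
  by exists (fun=> t0) => ic ac Nc; case: n.
pose phi (v : V) := match v.2 with inl n => f v.1 n | inr l => g v.1 l end.
pose dom := std_dom a b.
have phiD v : dom v -> [/\ D (phi v), lev (phi v) = v.1 & core (phi v) <-> std_core v].
  case: v => c [n|l] [/= ic ncore]; rewrite /phi /=.
    have [_ /(_ n)[? ? ?] _] := hf c ic; split=> //; split=> // _; by exists n.
  have [ac Nc] : lt a c /\ N c by apply: ncore => -[].
  by have [_ /(_ l)[? nc ?]] := hg c ic ac Nc; split=> //; split=> // -[].
have phiI v w : dom v -> dom w -> phi v = phi w -> v = w.
  move=> Dv Dw; have [_ lv cv] := phiD v Dv; have [_ lw cw] := phiD w Dw => e.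
  have e1 : v.1 = w.1 by rewrite -lv -lw e.
  rewrite e in cv; case: v Dv cv e1 e {lv} => c [n|l]; case: w Dw cw {lw} => d [m|k].
  - move=> [/= id _] _ [ic _] _ /= e1; subst d; rewrite /phi /=.
    by case: (hf c ic) => fI _ _ /fI->.
  - by move=> _ cw _ cv; exfalso; have [] : std_core (d, inr k) by apply/cw/cv; exists n.
  - by move=> _ cw _ cv; exfalso; have [] : std_core (c, inr l) by apply/cv/cw; exists m.
  - move=> Dw _ [ic ncore] _ /= e1; subst d; rewrite /phi /=.
    have [ac Nc] : lt a c /\ N c by apply: ncore => -[].
    by case: (hg c ic ac Nc) => gI _ /gI->.
have phi_core x : D x -> core x -> exists2 n, dom (lev x, inl n) & phi (lev x, inl n) = x.
  move=> Dx cx; have ix := gp_lev gp Dx.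
  have [_ _ /(_ x)[//|n fn]] := hf _ ix; exists n => //; split=> // -[].
  by exists n.
pose S v w := [/\ dom v, dom w & le (phi v) (phi w)].
exists S; split.
- by move=> v w [].
- by move=> v Dv; split=> //; apply: (gp_refl gp); case: (phiD v Dv).
- by move=> u v w [Du _ uv] [_ Dw vw]; split=> //; exact: (gp_trans gp uv vw).
- move=> v w [Dv Dw vw]; case: (gp_below gp vw) => [e|[cv]]; first by left; exact: phiI.
  have [_ -> cv'] := phiD v Dv; have [_ -> _] := phiD w Dw.
  by move=> vw'; right; split=> //; apply/cv'.
- by move=> v [].
- move=> v c Dv ic; have [Dpv lv _] := phiD v Dv => cv.
  have := gp_inf gp Dpv ic; rewrite lv => /(_ cv) inf fin; apply: inf.
  apply: (sub_finite_set _ (finite_image phi fin)) => x [lx xv].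
  have [e|[cx _]] := gp_below gp xv.
    by move: cv; rewrite -lx e lv => /(wo_irr wo).
  have [Dx _] := gp_dom gp xv; have [n Dn en] := phi_core x Dx cx.
  by exists (lev x, inl n); rewrite ?en//; split=> //; split=> //; rewrite en.
- move=> v w Dv Dw; have [Dpv _ _] := phiD v Dv; have [Dpw _ _] := phiD w Dw.
  have [F [finF Fvw FU]] := gp_meet gp Dpv Dpw.
  have /choice[psi hpsi] : forall x, exists u : V, F x -> dom u /\ phi u = x.
    move=> x; have [Fx|nFx] := pselect (F x); last by exists v.
    have [xv xw] := Fvw x Fx; case: (gp_below gp xv) => [-> |[cx _]]; first by exists v.
    by have [Dx _] := gp_dom gp xv; have [n Dn en] := phi_core x Dx cx; exists (lev x, inl n).
  apply: (graded_finite_image finF (f := psi)) => [x Fx|u [Du _ uv] [_ _ uw]].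
    have [Dx ex] := hpsi x Fx; have [xv xw] := Fvw x Fx.
    by split; split; rewrite ?ex.
  have [x Fx ux] := FU _ uv uw; exists x => //.
  by have [Dx ex] := hpsi x Fx; split; rewrite ?ex.
Qed.

(** * Adding a top level *)

Section Cap.
Context (T : Type) (lev : T -> J) (core D : set T) (le : T -> T -> Prop)
  (Lv : set J) (a b : J).
Hypothesis gp : graded_poset lt lev core D le Lv.
Hypothesis wd : wide lev core D Lv a.
Hypothesis Lvb : forall x, Lv x -> lt x b.

(** [inl x] is the old poset, [inr (n, Some x)] the point [x] in the [n]-th copy of its core, and
    [inr (n, None)] the new point above that copy. The copies are pairwise incomparable, so new
    points have no common lower bounds; being countably many copies of the core, they keep the core
    of each level countable. *)
Let CT := (T + nat * option T)%type.
Let clev (p : CT) := match p with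
  | inl x | inr (_, Some x) => lev x | inr (_, None) => b end.
Let ccore (p : CT) := if p is inl x then core x else True.
Let cdom (p : CT) := match p with
  | inl x => D x | inr (_, Some x) => D x /\ core x | inr (_, None) => True end.
Let cle (p q : CT) := match p, q with
  | inl x, inl y => le x y
  | inr (n, Some x), inr (m, Some y) => [/\ n = m, core x, core y & le x y]
  | inr (n, Some x), inr (m, None) => [/\ n = m, core x & D x]
  | inr (n, None), inr (m, None) => n = m
  | _, _ => False end.
Let cLv := [set x | Lv x \/ x = b].

Lemma cap_graded : graded_poset lt clev ccore cdom cle cLv.
Proof.
split.
- case=> [x|[n [x|]]] [y|[m [y|]]] //=; first exact: (gp_dom gp).
    by case=> _ cx cy /(gp_dom gp)[].
  by case.
- by case=> [x|[n [x|]]] //=; [exact: (gp_refl gp)|case=> Dx cx; split=> //; exact: (gp_refl gp)].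
- case=> [x|[n [x|]]] [y|[m [y|]]] [z|[k [z|]]] //=.
  + exact: (gp_trans gp).
  + by move=> [-> cx cy xy] [-> _ cz yz]; split=> //; exact: (gp_trans gp xy yz).
  + by move=> [-> cx cy /(gp_dom gp)[Dx _]] [-> _ _]; split.
  + by move=> [-> cx Dx] <-; split.
  + by move=> ->.
- case=> [x|[n [x|]]] [y|[m [y|]]] //=.
  + by move=> /(gp_below gp)[->|]; [left|right].
  + by move=> [-> cx cy /(gp_below gp)[->|[_]]]; [left|right].
  + by move=> [-> cx Dx]; right; split=> //; apply: Lvb; exact: (gp_lev gp Dx).
  + by move=> ->; left.
- case=> [x|[n [x|]]] /=; [by move=> /(gp_lev gp); left| |by right].
  by case=> /(gp_lev gp); left.
- case=> [x|[n [x|]]] c /= Dx ic.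
  + move=> cx; have Lc : Lv c.
      case: ic => // cb; move: cx; rewrite cb => /(wo_asym wo); case.
      by apply: Lvb; exact: (gp_lev gp Dx).
    apply: (infinite_image_inj (f := inl)) (gp_inf gp Dx Lc cx) => //.
    by move=> ? ? _ _ [].
  + case: Dx => Dx corex cx; have Lc : Lv c.
      case: ic => // cb; move: cx; rewrite cb => /(wo_asym wo); case.
      by apply: Lvb; exact: (gp_lev gp Dx).
    apply: (infinite_image_inj (f := fun y => inr (n, Some y))) (gp_inf gp Dx Lc cx).
      by move=> ? ? _ _ [].
    move=> y /= [ly yx]; split=> //; split=> //.
    by case: (gp_below gp yx) => [->|[]].
  + case: ic => [Lc _|->]; last by move=> /(wo_irr wo).
    apply: (infinite_image_inj (f := fun y => inr (n, Some y))) (wide_infinite wd Lc).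
      by move=> ? ? _ _ [].
    by move=> y /= [].
- have self p q : cle p q -> cdom p -> cle p p -> exists F : set CT,
    [/\ finite_set F, forall v, F v -> cle v p /\ cle v q &
        forall u, cle u p -> cle u q -> exists2 v, F v & cle u v].
    move=> pq Dp pp; exists [set p]; split; first exact: finite_set1.
      by move=> _ ->.
    by move=> u up _; exists p.
  have empty p q : (forall u, cle u p -> cle u q -> False) -> exists F : set CT,
    [/\ finite_set F, forall v, F v -> cle v p /\ cle v q &
        forall u, cle u p -> cle u q -> exists2 v, F v & cle u v].
    by move=> E; exists set0; split=> // u up /(E u up).
  have flip p q : (exists F : set CT,
    [/\ finite_set F, forall v, F v -> cle v p /\ cle v q &
        forall u, cle u p -> cle u q -> exists2 v, F v & cle u v]) -> exists F : set CT,
    [/\ finite_set F, forall v, F v -> cle v q /\ cle v p &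
        forall u, cle u q -> cle u p -> exists2 v, F v & cle u v].
    move=> [F [fF F1 F2]]; exists F; split=> //; first by move=> v /F1[].
    by move=> u uq up; apply: F2.
  case=> [x|[n [x|]]] [y|[m [y|]]] //= Dx Dy; try by apply: empty => -[?|[? [?|]]] /=.
  + have [F [finF Fxy FU]] := gp_meet gp Dx Dy.
    apply: (graded_finite_image (f := inl) finF) => //.
    by case=> [u|[k [u|]]] //=; apply: FU.
  + have [<-{m}|nm] := pselect (n = m); last first.
      by apply: empty => -[?|[? [?|]]] //= [-> _ _ _] [/nm].
    case: Dx Dy => [Dx cx] [Dy cy].
    have [F [finF Fxy FU]] := gp_meet gp Dx Dy.
    apply: (graded_finite_image (f := fun v => inr (n, Some v)) finF) => /=.
      move=> v /Fxy[vx vy]; split; split=> //;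
      by case: (gp_below gp vx) => [->|[]].
    case=> [u|[k [u|]]] //= [-> cu _ ux] [_ _ _ uy].
    by have [v Fv uv] := FU _ ux uy; exists v => //; split=> //; case: (Fxy v Fv) =>
      /(gp_below gp)[->|[]].
  + have [<-{m}|nm] := pselect (n = m); last first.
      by apply: empty => -[?|[? [?|]]] //= [-> _ _ _] [/nm].
    case: Dx => [Dx cx]; apply: self => //=; split=> //; exact: (gp_refl gp).
  + apply: flip; have [<-{m}|nm] := pselect (n = m); last first.
      by apply: empty => -[?|[? [?|]]] //= [-> _ _ _] [/esym/nm].
    case: Dy => [Dy cy]; apply: self => //=; split=> //; exact: (gp_refl gp).
  + have [<-{m}|nm] := pselect (n = m); last first.
      by apply: empty => -[?|[? [?|]]] //=; [case=> -> _ _ [/nm]|move=> -> /nm].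
    exact: self.
Qed.

Lemma cap_wide : ~ N b -> wide clev ccore cdom cLv a.
Proof.
move=> Nb; split=> c.
(* No point of [D] has level [b], so a constant code works there. *)
- move=> ic; have [k kI] : exists k : T -> nat, forall x y, D x -> core x -> lev x = c ->
    D y -> core y -> lev y = c -> k x = k y -> x = y.
    case: ic => [/(wide_countable wd)/countable_code[k kI]|->].
      by exists k => x y *; apply: kI.
    exists (fun=> 0) => x y /(gp_lev gp)/Lvb + _ lx.
    by rewrite lx => /(wo_irr wo).
  pose code (p : CT) : nat + nat * option nat := match p with
    | inl x => inl (k x) | inr (n, ox) => inr (n, omap k ox) end.
  apply: (countable_inj (f := code)).
  case=> [x|[n [x|]]] [y|[m [y|]]] //= [Dx cx lx] [Dy cy ly] [].
  + by move=> /kI->.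
  + by move=> -> /kI->//; [case: Dx|case: Dx|case: Dy|case: Dy].
  + by move=> ->.
- case=> [Lc|->].
    apply: (infinite_image_inj (f := inl)) (wide_infinite wd Lc) => //.
    by move=> ? ? _ _ [].
  by apply: (infinite_range (f := fun n => inr (n, None))) => // m n [].
- move=> [Lc|->] ac Nc //; have [g [gI hg]] := wide_rest wd Lc ac Nc.
  by exists (inl \o g); split=> // x y [/gI].
Qed.

End Cap.

End UniversalPosets.

(** * Stretching a skeleton *)

Section Skeleton.
Context (L W : Type) (ltW : W -> W -> Prop) (woW : wellorder ltW) (T : Type)
  (pi : T -> W) (leT : T -> T -> Prop) (i : T -> T -> set T) (O : W -> set T).
Hypothesis sk : skeleton ltW pi leT i O.
Hypothesis rest : forall w, exists g : L -> T, injective g /\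
  forall l, pi (g l) = w /\ ~ O w (g l).

Definition skel_core : set T := [set s | O (pi s) s].
Local Notation core := skel_core.

Lemma skel_refl s : leT s s.
Proof. by case: sk => -[+ _] _; apply. Qed.

Lemma skel_trans s t u : leT s t -> leT t u -> leT s u.
Proof. by case: sk => -[_ [_ [+ _]]] _; apply. Qed.

Lemma skel_below s t : leT s t -> s = t \/ core s /\ ltW (pi s) (pi t).
Proof.
move=> st; have [|ne] := pselect (s = t); [by left|right].
case: sk => -[_ [_ [_ [_ [mono _]]]]] [_ [_ [cO _]]].
by split; [apply: cO (conj st ne)|apply: mono].
Qed.

Lemma skel_inf w t : ltW w (pi t) -> infinite_set [set s | O w s /\ leT s t].
Proof.
move=> wt; case: sk => -[_ [_ [_ [_ [_ [inf _]]]]]] [_ [_ [cO _]]].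
apply: sub_infinite_set (inf w t wt) => s [ps [st ne]]; split=> //.
by rewrite -ps; apply: cO (conj st ne).
Qed.

Lemma skel_meet s t : exists F : set T, [/\ finite_set F,
  forall v, F v -> leT v s /\ leT v t &
  forall u, leT u s -> leT u t -> exists2 v, F v & leT u v].
Proof.
have [<-|ne] := pselect (s = t).
  exists [set s]; split=> [|_ ->|u us _]; first exact: finite_set1.
    by split; apply: skel_refl.
  by exists s.
case: sk => -[_ [_ [_ [_ [_ [_ [_ [fin [sub sup]]]]]]]]] _.
by exists (i s t); split; [apply: fin|apply: sub|apply: sup].
Qed.

Lemma skel_pi w s : O w s -> pi s = w.
Proof. by case: sk => _ [+ _]; apply. Qed.

Lemma skel_coreE w s : O w s -> core s.
Proof. by move=> Os; rewrite /core /= (skel_pi Os). Qed.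

(** A common lower bound would have to lie under an element of [i s t], which is empty inside
    [O w]. *)
Lemma skel_disjoint w s t u : O w s -> O w t -> leT u s -> leT u t -> s = t.
Proof.
move=> Os Ot us ut; apply: contrapT => ne.
case: sk => -[_ [_ [_ [_ [_ [_ [_ [_ [_ sup]]]]]]]]] [_ [_ [_ [disj _]]]].
have [v] := sup s t ne u us ut.
by rewrite (disj w).
Qed.

Lemma skel_succ w s t : succ_of ltW w (pi t) -> leT s t -> s <> t ->
  exists2 u, O w u & leT s u /\ leT u t.
Proof.
move=> wt st ne; case: sk => _ [_ [_ [_ [_ suc]]]].
by have [u Ou [su [ut _]]] := suc w _ s t wt erefl (conj st ne); exists u.
Qed.

Lemma skel_countable w : countable (O w).
Proof. by case: sk => _ [_ [/(_ w)[]]]. Qed.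

Lemma skel_infinite w : infinite_set (O w).
Proof. by case: sk => _ [_ [/(_ w)[]]]. Qed.

Context (J : Type) (lt : J -> J -> Prop) (wo : wellorder lt) (N : set J).

(** The two lowest levels of the skeleton suffice when nothing lies between [a] and [b]: [O w0]
    becomes level [a], and all of level [w1] becomes level [b], which brings the points outside the
    core. *)
Lemma universal_succ (a b : J) (w0 w1 : W) : (forall w, ~ ltW w w0) ->
  succ_of ltW w0 w1 -> succ_of lt a b -> universal L lt N a b.
Proof.
move=> min0 [w01 suc] [ab nab].
pose lev t := if pselect (pi t = w0) then a else b.
pose dom := [set t | O w0 t \/ pi t = w1].
have ne01 : w1 <> w0 by move=> e; move: w01; rewrite e => /min0.
have lev0 t : pi t = w0 -> lev t = a by rewrite /lev; case: pselect.
have lev1 t : pi t = w1 -> lev t = b.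
  by rewrite /lev; case: pselect => // t0 t1; case: ne01; rewrite -t1.
have below s t : dom t -> leT s t -> s = t \/ [/\ O w0 s, pi s = w0 & pi t = w1].
  move=> Dt /skel_below[|[cs st]]; [by left|right; move: st].
  case: Dt => [/skel_pi->/min0//|pt]; rewrite pt => s1.
  have s0 : pi s = w0.
    by case: (wo_total woW (pi s) w0) => // [/min0//|/suc].
  by split=> //; rewrite -{1}s0.
have intE x : interval lt a b x -> x = a \/ x = b.
  case=> xa bx; case: (nlt_eqVlt wo xa) => [|ax]; first by left.
  by right; case: (nlt_eqVlt wo bx) => // /(nab _ ax).
have inta : interval lt a b a by split; [exact: (wo_irr wo)|exact: (wo_asym wo ab)].
have intb : interval lt a b b by split; [exact: (wo_asym wo ab)|exact: (wo_irr wo)].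
pose S s t := [/\ dom s, dom t & leT s t].
apply: (universal_of_wide wo (lev := lev) (core := core) (D := dom) (le := S)).
- exact: (wo_asym wo ab).
- split.
  + by move=> s t [].
  + by move=> s Ds; split=> //; apply: skel_refl.
  + by move=> s t u [Ds _ st] [_ Du tu]; split=> //; apply: skel_trans tu.
  + move=> s t [Ds Dt /(below _ _ Dt)[|[Os s0 t1]]]; [by left|right].
    by split; [exact: skel_coreE Os|rewrite lev0// lev1].
  + by move=> s [/skel_pi/lev0->|/lev1->].
  + move=> t c [/skel_pi/lev0->|pt] ic; first by case: ic.
    rewrite lev1// => cb; have {ic cb} -> : c = a.
      by case: (intE _ ic) => // e; case: (wo_irr wo (x := b)); rewrite -{1}e.
    have tw : ltW w0 (pi t) by rewrite pt.
    apply: sub_infinite_set (skel_inf tw) => s [Os st]; split.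
      by apply: lev0; exact: skel_pi.
    by split; [left|right|].
  + move=> s t Ds Dt; have [F [finF Fst FU]] := skel_meet s t.
    apply: (graded_finite_image finF (f := id)) => [v Fv|u [Du _ us] [_ _ ut]].
      have [vs vt] := Fst v Fv.
      by case: (below _ _ Ds vs) => [?|[Ov _ _]]; [subst v|]; split; split=> //; left.
    have [v Fv uv] := FU u us ut; exists v => //; split=> //.
    by case: (below _ _ Ds (Fst v Fv).1) => [->//|[Ov _ _]]; left.
- split=> c.
  + move=> /intE[]->.
      apply: sub_countable (skel_countable w0); apply: subset_card_le.
      move=> t [[//|/lev1 e] _]; rewrite e => eba.
      by case: (wo_irr wo (x := b)); rewrite {1}eba.
    apply: sub_countable (skel_countable w1); apply: subset_card_le.
    move=> t [[/skel_pi/lev0 e|e] + +]; last by rewrite /core /= e.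
    by rewrite e => _ eab; case: (wo_irr wo (x := b)); rewrite -{1}eab.
  + move=> /intE[]->.
      apply: sub_infinite_set (skel_infinite (w := w0)) => t Ot.
      by split; [left|exact: skel_coreE Ot|apply: lev0; exact: skel_pi].
    apply: sub_infinite_set (skel_infinite (w := w1)) => t Ot.
    by split; [right; exact: skel_pi|exact: skel_coreE Ot|apply: lev1; exact: skel_pi].
  + move=> /intE[]-> ac Nc; first by case: (wo_irr wo ac).
    have [g [gI hg]] := rest w1; exists g; split=> // l; have [pg ng] := hg l.
    by split; [right|rewrite /core /= pg|apply: lev1].
Qed.


Section Insertion.
Local Notation V := (J * (nat + L))%type.
Local Notation stdc := (@std_core L J).
(** [DW] is the part of [W] in use, [pr] gives predecessors, [e t] lists core points one level below
    [t], and [tt w] is the point outside the core that gives way to a full copy. Points under [t]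
    missed by [e t] stay below [t] with nothing inserted in between. *)
Context (a : J) (DW : set W) (eta : W -> J) (pr : W -> W) (e : T -> nat -> T)
  (tt : W -> T) (S : W -> V -> V -> Prop).
Local Notation sw w := (succ_of ltW (pr w) w).
Hypothesis DW_down : forall v w, DW w -> ltW v w -> DW v.
Hypothesis eta_ge : forall w, ~ lt (eta w) a.
Hypothesis eta_mono : forall v w, DW w -> ltW v w -> lt (eta v) (eta w).
Hypothesis eta_cont : forall w x, DW w -> ~ lt x a ->
  (forall v, ~ succ_of ltW v w) -> (forall v, ltW v w -> lt (eta v) x) ->
  ~ lt x (eta w).
Hypothesis prP : forall v w, succ_of ltW v w -> sw w.
Hypothesis eP : forall t, sw (pi t) ->
  injective (e t) /\ forall n, O (pr (pi t)) (e t n) /\ leT (e t n) t.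
Hypothesis ttP : forall w, pi (tt w) = w /\ ~ core (tt w).
Hypothesis SP : forall w, DW w -> sw w -> graded_poset lt fst stdc
  (std_dom lt N (eta (pr w)) (eta w)) (S w) (interval lt (eta (pr w)) (eta w)).

(* [inl s] is a point [s] of the skeleton and [inr (t, y)] the point [y] of the
   copy inserted below [t].  The bottom point [bt t n] of that copy is identified
   with the point [e t n] of the skeleton.  [low q] is the set of skeleton points
   below [q], and an inserted [(t, y)] with [t] in the core is below exactly the
   [q] with [t] in [low q] and the points of the same copy above it. *)
Let IT := (T + T * V)%type.
Let ilev (p : IT) := match p with inl s => eta (pi s) | inr (t, y) => y.1 end.
Let icore (p : IT) := match p with inl s => core s | inr (t, y) => stdc y end.
(** A core point [t] stays on top of its copy, so only core points strictly below its level are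
    inserted there. The copy for [tt w] keeps its top level, and [tt w] itself disappears with the
    other points outside the core of a successor level. Bottom levels are omitted since the [e t n]
    take their place. *)
Let idom (p : IT) := match p with
  | inl s => DW (pi s) /\ (core s \/ forall v, ~ succ_of ltW v (pi s))
  | inr (t, y) => [/\ DW (pi t), sw (pi t),
      std_dom lt N (eta (pr (pi t))) (eta (pi t)) y, lt (eta (pr (pi t))) y.1 &
      [/\ core t, stdc y & lt y.1 (eta (pi t))] \/ t = tt (pi t)]
  end.
Let bt t n : V := (eta (pr (pi t)), inl n).
Let low (q : IT) (s : T) := match q with
  | inl t => leT s t
  | inr (t, y) => exists2 n, leT s (e t n) & S (pi t) (bt t n) y end.
Let ile0 (p q : IT) := match p with
  | inl s => low q s
  | inr (t, y') => core t /\ low q t \/ exists2 y, q = inr (t, y) & S (pi t) y' y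
  end.
Let ile (p q : IT) := [/\ idom p, idom q & ile0 p q].
Let iLv := [set x | ~ lt x a /\ exists2 w, DW w & ~ lt (eta w) x].

Let low_down q s s' : low q s -> leT s' s -> low q s'.
Proof.
case: q => [t|[t y]] /=; first by move=> st s's; exact: skel_trans s's st.
by move=> [n sn Sn] s's; exists n => //; exact: skel_trans s's sn.
Qed.

Let ile_trans p q r : ile p q -> ile q r -> ile p r.
Proof.
move=> [Dp Dq pq] [_ Dr qr]; split=> //.
have mono s : low q s -> low r s.
  case: q Dq qr {pq} => [t|[t y]] /=; first by move=> _ rt st; exact: low_down rt st.
  move=> [DWt swt Dy prt _] [[ct rt]|[y2 -> yy2]] [n sn Sn].
    by apply: low_down rt _; apply: skel_trans sn _; have [_ /(_ n)[]] := eP swt.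
  by exists n => //; exact: (gp_trans (SP DWt swt) Sn yy2).
case: p Dp pq => [s|[t y']] /=; first by move=> _; exact: mono.
move=> [DWt swt _ _ _] [[ct /mono rt]|[y eq yy]]; first by left.
move: qr; rewrite eq /= => -[|[y2 -> yy2]]; [by left|right].
by exists y2 => //; exact: (gp_trans (SP DWt swt) yy yy2).
Qed.

Let low_core q s : idom q -> low q s -> idom (inl s) /\
  (q = inl s \/ core s /\ lt (eta (pi s)) (ilev q)).
Proof.
case: q => [t|[t y]] /=.
  move=> [DWt ct] /skel_below[->|[cs st]]; first by split=> //; left.
  by split; [split; [exact: DW_down DWt st|left]|right; split=> //; exact: eta_mono].
move=> [DWt swt Dy prt _] [n sn Sn]; have [_ /(_ n)[On nt]] := eP swt.
have pn := skel_pi On; have DWp := DW_down DWt swt.1.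
case: (skel_below sn) => [->|[cs]]; rewrite pn.
  split; first by split=> //; left; exact: skel_coreE On.
  by right; split=> //; exact: skel_coreE On.
move=> sp; split; first by split; [exact: DW_down DWp sp|left].
by right; split=> //; apply: (wo_trans wo) prt; exact: eta_mono.
Qed.

Let low_anc q s : idom q -> low q s ->
  leT s (match q with inl t => t | inr (t, _) => t end).
Proof.
case: q => [t|[t y]] //= [_ swt _ _ _] [n sn _].
by apply: skel_trans sn _; have [_ /(_ n)[]] := eP swt.
Qed.

(** Take the least [w] with [eta w] not below [x]: by continuity [eta w] equals [x] unless [w] is a
    successor. *)
Let iLv_split x : iLv x -> exists w, [/\ DW w, forall v, ltW v w -> lt (eta v) x,
  ~ lt (eta w) x & (eta w = x /\ forall v, ~ succ_of ltW v w) \/ sw w].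
Proof.
move=> [xa [w0 D0 x0]].
have [w [[Dw wx] wmin]] := wo_least woW (P := fun w => DW w /\ ~ lt (eta w) x)
  (ex_intro _ w0 (conj D0 x0)).
have below v : ltW v w -> lt (eta v) x.
  move=> vw; apply: contrapT => nv; apply: (wmin v) => //; split=> //.
  exact: DW_down Dw vw.
exists w; split=> //; have [[v /prP]|n] := pselect (exists v, succ_of ltW v w).
  by right.
have nsucc v : ~ succ_of ltW v w by move=> h; apply: n; exists v.
left; split=> //; have xw := eta_cont Dw xa nsucc below.
by case: (nlt_eqVlt wo wx) => // /xw.
Qed.

(* The copy of [v] in the poset inserted below [t]. *)
Let emb t (v : V) : IT :=
  if pselect (v.1 = eta (pr (pi t))) is left _
  then if v.2 is inl n then inl (e t n) else inr (t, v) else inr (t, v).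

Let embE t y v : idom (inr (t, y)) -> S (pi t) v y ->
  (exists n, v = bt t n /\ emb t v = inl (e t n)) \/
  (lt (eta (pr (pi t))) v.1 /\ emb t v = inr (t, v)).
Proof.
move=> [DWt swt Dy prt _] vy; have [[[vp vt] ncore] _] := gp_dom (SP DWt swt) vy.
rewrite /emb; case: pselect => [ev|nev].
  left; case: v ev {vp vt vy} ncore => c [n|l] /= -> ncore; first by exists n.
  have [+ _] : lt (eta (pr (pi t))) (eta (pr (pi t))) /\ N (eta (pr (pi t))).
    by apply: ncore => -[].
  by move/(wo_irr wo).
by right; split=> //; case: (nlt_eqVlt wo vp) => // ev; case: nev.
Qed.

Let emb_le t y v : idom (inr (t, y)) -> S (pi t) v y ->
  ile (emb t v) (inr (t, y)) /\ ilev (emb t v) = v.1.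
Proof.
move=> Dty vy; have [DWt swt Dy prt ty] := Dty.
have [_ he] := eP swt.
case: (embE Dty vy) => [[n [ev ->]]|[pv ->]].
  have [On nt] := he n; rewrite /= (skel_pi On) ev; split=> //; split=> //.
    by split; rewrite ?(skel_pi On); [exact: DW_down swt.1|left; exact: skel_coreE On].
  by exists n; [exact: skel_refl|rewrite -ev].
split=> //; split=> //; last by right; exists y.
have [Dv _] := gp_dom (SP DWt swt) vy.
split=> //; case: ty => [[ct cy yt]|->]; [left|right; by rewrite (ttP _).1].
case: (gp_below (SP DWt swt) vy) => [->//|[cv vy']]; split=> //.
exact: (wo_trans wo vy' yt).
Qed.

Let emb_inj t y v v' : idom (inr (t, y)) -> S (pi t) v y -> S (pi t) v' y ->
  emb t v = emb t v' -> v = v'.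
Proof.
move=> Dty vy v'y; have [_ swt _ _ _] := Dty; have [eI _] := eP swt.
case: (embE Dty vy) => [[n [-> ->]]|[_ ->]];
case: (embE Dty v'y) => [[n' [-> ->]]|[_ ->]] // [] //.
by move=> /eI->.
Qed.

(** If [c] is some [eta w], the skeleton itself provides the points. Otherwise [c] lies strictly
    inside a gap ending at [eta w], and a core point [t'] of level [w] under [t], possibly [t]
    itself, has a copy inserted below it that meets level [c]. *)
Let inf_old t c : idom (inl t) -> iLv c -> lt c (eta (pi t)) ->
  infinite_set [set p | ilev p = c /\ ile p (inl t)].
Proof.
move=> Dt ic ct; have [DWt coret] := Dt.
have [w [Dw below wc cases]] := iLv_split ic.
have wt : w = pi t \/ ltW w (pi t).
  by apply: (nlt_eqVlt woW) => /below /(wo_asym wo).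
have [ec|nec] := pselect (eta w = c).
  case: wt => [ew|wt]; first by move: ct; rewrite -ec ew => /(wo_irr wo).
  apply: (infinite_image_inj (f := inl)) (skel_inf wt) => [? ? _ _ []//|s [Os st]] /=.
  rewrite (skel_pi Os); split=> //; split=> //.
  by split; [apply: (DW_down DWt); rewrite (skel_pi Os)|left; exact: skel_coreE Os].
case: cases => [[]//|sww].
have cw : lt c (eta w) by case: (nlt_eqVlt wo wc) => // e'; case: nec.
have [t' [ct' pt' t't]] : exists t', [/\ core t', pi t' = w & leT t' t].
  case: wt => [ew|wt].
    exists t; split=> //; last exact: skel_refl.
    by case: coret => // ns; case: (ns (pr w)); rewrite -ew.
  have [t' [Ot' t't]] := infinite_setN0 (skel_inf wt).
  by exists t'; split=> //; [exact: skel_coreE Ot'|exact: skel_pi Ot'].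
apply: (infinite_range (f := fun n => inr (t', (c, inl n)))) => [m n []//|n].
split=> //; split=> //; last by left.
rewrite /= pt'; split=> //; first split=> /=.
- by split=> //; exact: (wo_asym wo (below _ sww.1)).
- by case; exists n.
- exact: below sww.1.
- by left; split=> //; exists n.
Qed.

(** Below an inserted point, levels of its own copy are handled inside [S]; for lower levels one
    descends to a bottom point [e t n] and uses the skeleton points' case. *)
Let ins_inf q c : idom q -> iLv c -> lt c (ilev q) ->
  infinite_set [set p | ilev p = c /\ ile p q].
Proof.
case: q => [t|[t y]]; first exact: inf_old.
move=> Dty ic /= cy; have [DWt swt Dy prt _] := Dty.
have inf c' : ~ lt c' (eta (pr (pi t))) -> lt c' y.1 ->
    infinite_set [set v | v.1 = c' /\ S (pi t) v y].
  move=> pc c'y; apply: (gp_inf (SP DWt swt)) => //; split=> // tc'.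
  by apply: Dy.1.2; exact: (wo_trans wo tc').
have [pc|npc] := pselect (lt c (eta (pr (pi t)))); last first.
  apply: (infinite_image_inj (f := emb t)) (inf c npc cy).
    by move=> v v' [_ vy] [_ v'y]; exact: emb_inj vy v'y.
  by move=> v [ev vy]; have [? elev] := emb_le Dty vy; split=> //; rewrite elev.
have [v [ev vy]] := infinite_setN0 (inf _ (wo_irr wo (x := _)) prt).
case: (embE Dty vy) => [[n [_ en]]|[]]; last by rewrite ev => /(wo_irr wo).
have [nle nlev] := emb_le Dty vy; rewrite en in nle nlev.
have [Dn _ _] := nle.
have cn : lt c (eta (pi (e t n))) by rewrite [eta _]nlev ev.
apply: sub_infinite_set (inf_old Dn ic cn) => p [pc' pn]; split=> //.
exact: ile_trans pn nle.
Qed.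

(** A point [v] strictly below [t] lies under some [u] in the level preceding [t]. Since [u] and
    [e t n] are both above [x], disjointness makes them equal. *)
Let low_up q x v : idom q -> low q x -> leT x v ->
  leT v (match q with inl t => t | inr (t, _) => t end) ->
  (if q is inr (t, _) then v <> t else True) -> low q v.
Proof.
case: q => [t|[t y]] //= [_ swt _ _ _] [n xn Sn] xv vt ne.
have [u Ou [vu ut]] := skel_succ swt vt ne.
have [_ /(_ n)[On _]] := eP swt.
exists n => //; have -> := skel_disjoint On Ou xn (skel_trans xv vu).
exact: vu.
Qed.

Let anchor (q : IT) : T := match q with inl t => t | inr (t, _) => t end.

Let ile_cases u p : ile u p ->
  (low p (anchor u) /\ if u is inr _ then core (anchor u) else True) \/
  exists t y' y, [/\ u = inr (t, y'), p = inr (t, y) & S (pi t) y' y].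
Proof.
case: u => [s|[t y']] [_ _] /=; first by left.
move=> [[ct pt]|[y -> yy]]; first by left.
by right; exists t, y', y.
Qed.

Let ile_low u q : idom u -> idom q -> low q (anchor u) ->
  (if u is inr _ then core (anchor u) else True) -> ile u q.
Proof. by case: u => [s|[t y]] Du Dq uq cu; split=> //; left. Qed.

Let low_irr t y : idom (inr (t, y)) -> ~ low (inr (t, y)) t.
Proof.
move=> [_ swt _ _ _] [n tn _]; have [_ /(_ n)[/skel_pi pn _]] := eP swt.
case: (skel_below tn) => [etn|[_]]; last by rewrite pn => /(wo_asym woW swt.1).
by have := swt.1; rewrite -pn -etn; exact: (wo_irr woW).
Qed.

Let ile_refl p : idom p -> ile p p.
Proof.
case: p => [s|[t y]] Dp; first by split=> //; exact: skel_refl.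
have [DWt swt Dy _ _] := Dp.
by split=> //; right; exists y => //; exact: (gp_refl (SP DWt swt)).
Qed.

Let meet_comparable p q : ile p q -> exists F : set IT, [/\ finite_set F,
  forall v, F v -> ile v p /\ ile v q &
  forall u, ile u p -> ile u q -> exists2 v, F v & ile u v].
Proof.
move=> pq; have [Dp _ _] := pq.
exists [set p]; split=> [|_ ->|u up _]; first exact: finite_set1.
  by split=> //; exact: ile_refl.
by exists p.
Qed.

(** The meet is taken in [S] and transported by [emb]. A common lower bound from outside the copy
    lies under a single bottom point, because the cones of the [e t n] are disjoint, and that bottom
    point is bounded within [S]. *)
Let meet_same t y1 y2 : idom (inr (t, y1)) -> idom (inr (t, y2)) ->
  exists F : set IT, [/\ finite_set F,
  forall v, F v -> ile v (inr (t, y1)) /\ ile v (inr (t, y2)) &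
  forall u, ile u (inr (t, y1)) -> ile u (inr (t, y2)) ->
    exists2 v, F v & ile u v].
Proof.
move=> D1 D2; have [DWt swt Dy1 _ _] := D1; have [_ _ Dy2 _ _] := D2.
have [eI he] := eP swt; have gpS := SP DWt swt.
have [F [finF F12 FU]] := gp_meet gpS Dy1 Dy2.
apply: (graded_finite_image finF (f := emb t)) => [v Fv|u u1 u2].
  have [v1 v2] := F12 v Fv.
  by split; [case: (emb_le D1 v1)|case: (emb_le D2 v2)].
have Du : idom u by case: u1.
case: (ile_cases u1) => [[low1 cu]|[t' [y' [y1' [eu e1 S1]]]]].
  case: (ile_cases u2) => [[low2 _]|[t' [y' [_ [eu [et _] _]]]]]; last first.
    by case: (low_irr D1); move: low1; rewrite eu /= -et.
  case: low1 low2 => [n un S1] [n' un' S2].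
  have en : e t n = e t n' := skel_disjoint (he n).1 (he n').1 un un'.
  rewrite -(eI _ _ en) in S2; have [v Fv nv] := FU _ S1 S2; exists v => //.
  have [v1 _] := F12 v Fv; have [[Dv _ _] _] := emb_le D1 v1.
  apply: ile_low => //; case: (embE D1 v1) => [[m [ev ->]]|[_ ->]]; last by exists n.
  rewrite ev in nv; case: (gp_below gpS nv) => [[<-]//|[_ /=]].
  by move=> /(wo_irr wo).
case: e1 S1 eu => <- <- S1 eu.
rewrite {}eu in u2 Du *; case: (ile_cases u2) => [[low2 _]|[t2 [y2' [y2'' [eu2 e2 S2]]]]].
  by case: (low_irr D2).
case: eu2 e2 S2 => <- <- [<-] S2.
have [v Fv y'v] := FU _ S1 S2; exists v => //.
have [v1 _] := F12 v Fv; have [[Dv _ _] _] := emb_le D1 v1.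
split=> //; case: (embE D1 v1) => [[m [ev _]]|[_ ->]]; last by right; exists v.
have [_ _ _ py' _] := Du; rewrite ev in y'v.
case: (gp_below gpS y'v) py' => [->|[_ /= /(wo_asym wo) ny' /ny']//].
by move=> /(wo_irr wo).
Qed.

(** For incomparable points with distinct anchors, the meet of the anchors in the skeleton is used,
    restricted to the elements lying under both [p] and [q]. *)
Let ins_meet p q : idom p -> idom q -> exists F : set IT, [/\ finite_set F,
  forall v, F v -> ile v p /\ ile v q &
  forall u, ile u p -> ile u q -> exists2 v, F v & ile u v].
Proof.
move=> Dp Dq; have [pq|npq] := pselect (ile p q); first exact: meet_comparable.
have [qp|nqp] := pselect (ile q p).
  have [F [finF Fqp FU]] := meet_comparable qp; exists F; split=> //.
    by move=> v /Fqp[].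
  by move=> u up uq; exact: FU.
have old_new t y : idom (inl t) -> idom (inr (t, y)) -> ile (inr (t, y)) (inl t).
  move=> Dt Dty; apply: ile_low => //; first exact: skel_refl.
  have [_ swt _ _ _] := Dty; case: Dt => _ [//|ns].
  by case: (ns _ swt).
have [same|ne] := pselect (anchor p = anchor q).
  case: p q same Dp Dq npq nqp => [s|[s y1]] [t|[t y2]] /= <- Dp Dq npq nqp.
  - by case: npq; exact: ile_refl.
  - by case: nqp; exact: old_new.
  - by case: npq; exact: old_new.
  - exact: meet_same.
(* The exception [v = t] in [low_up] would put the anchor of [r] under [r'], and then [r] itself
   below [r']. *)
have up x v r r' : idom r -> idom r' -> ~ ile r r' -> anchor r <> anchor r' ->
    low r x -> low r' x -> leT x v -> leT v (anchor r) -> leT v (anchor r') -> low r v.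
  move=> Dr Dr' nrr' rr' rx r'x xv vr vr'; apply: (low_up Dr rx xv vr).
  case: r Dr nrr' rr' rx vr => [//|[t y]] Dr nrr' tr' rx vr evt.
  rewrite {v vr}evt in xv vr'; apply: nrr'.
  apply: ile_low => //=; last by case: (skel_below vr') => [/tr'|[]].
  by apply: (low_up Dr' r'x xv vr'); case: (r') tr' => [|[]].
have [F [finF Fpq FU]] := skel_meet (anchor p) (anchor q).
pose G : set IT := inl @` (F `&` [set v | low p v /\ low q v]).
exists G; split.
- by apply: finite_image; exact: finite_setIl.
- move=> _ [v [Fv [pv qv]] <-]; have [Dv _] := low_core Dp pv.
  by split; apply: ile_low.
(* If [u] is in the same copy as [r], then either [r] would be below [r'] as well, or [r'] would
   share the anchor of [r]. *)
- have B r r' u : idom r' -> ile u r -> ile u r' -> ~ ile r r' ->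
      anchor r <> anchor r' -> low r (anchor u).
    move=> Dr' ur ur' nrr' rr'.
    case: (ile_cases ur) => [[]//|[t [y' [y [eu er yy]]]]].
    case: (ile_cases ur') => [[lowr' cu]|[t' [y3 [y2 [eu' er' _]]]]].
      case: nrr'; case: ur => _ Dr _; apply: ile_low => //.
        by rewrite eu in lowr'; rewrite er.
      by rewrite er; rewrite eu in cu.
    by case: rr'; rewrite er er' /=; move: eu'; rewrite eu => -[].
  move=> u uup uuq.
  have px := B _ _ _ Dq uup uuq npq ne.
  have qx := B _ _ _ Dp uuq uup nqp (nesym ne).
  have [v Fv xv] := FU _ (low_anc Dp px) (low_anc Dq qx).
  have [vp vq] := Fpq v Fv.
  have pv := up _ _ _ _ Dp Dq npq ne px qx xv vp vq.
  have qv := up _ _ _ _ Dq Dp nqp (nesym ne) qx px xv vq vp.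
  exists (inl v); first by exists v.
  have [Dv _] := low_core Dp pv; have [Du _ _] := uup.
  apply: ile_low => //; case: (ile_cases uup) => [[]//|[t [y' [y [eu ep _]]]]].
  case: (ile_cases uuq) => [[]//|[t2 [y2' [y2 [eu2 eq2 _]]]]].
  by case: ne; rewrite ep eq2 /=; move: eu2; rewrite eu => -[].
Qed.

Lemma insertion_graded : graded_poset lt ilev icore idom ile iLv.
Proof.
split.
- by move=> p q [].
- exact: ile_refl.
- exact: ile_trans.
- move=> p q [Dp Dq pq].
  have bq s : low q s -> ~ lt (ilev q) (eta (pi s)).
    move=> /(low_core Dq)[_ [->|[_]]]; first exact: (wo_irr wo).
    exact: (wo_asym wo).
  case: p Dp pq => [s|[t y]] Dp /=.
    by move=> /(low_core Dq)[_ [->|]]; [left|right].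
  have [DWt swt Dy prt ty] := Dp.
  case=> [[ct /bq qt]|[y2 -> yy2]].
    right; case: ty => [[_ cy yt]|ett]; last by case: (ttP (pi t)); rewrite -ett.
    by split=> //; exact: (lt_nlt_trans wo yt qt).
  by case: (gp_below (SP DWt swt) yy2) => [->|]; [left|right].
- case=> [s|[t y]] /=.
    by move=> [Ds _]; split; [exact: eta_ge|exists (pi s) => //; exact: (wo_irr wo)].
  move=> [DWt swt [[_ ty] _] prt _]; split; last by exists (pi t).
  by move=> ya; apply: (@eta_ge (pr (pi t))); exact: (wo_trans wo prt ya).
- by move=> q c; exact: ins_inf.
- exact: ins_meet.
Qed.

(** A level strictly inside a gap, or at its upper end, determines the index [w] of the gap, so its
    core is coded by an index for [t] and one inside the copy; [None] codes [tt w]. The copy for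
    [tt w] supplies the [L] many points outside the core, and at levels [eta w] with [w] not a
    successor the skeleton supplies them. *)
Lemma insertion_wide : wide L lt N ilev icore idom iLv a.
Proof.
have dom_tt w c v : DW w -> sw w -> lt (eta (pr w)) c -> ~ lt (eta w) c ->
    v.1 = c -> (~ stdc v -> N c) -> idom (inr (tt w, v)).
  move=> Dw sww wc cw ev Nv; have [ptt _] := ttP w.
  rewrite /= ptt ev; split=> //; last by right.
  split; rewrite /= ev; last by move=> /Nv.
  by split=> //; exact: (wo_asym wo wc).
split=> c.
- move=> _; have /choice[k kI] : forall w, exists k : T -> nat,
      forall x y, O w x -> O w y -> k x = k y -> x = y.
    by move=> w; exact: countable_code (skel_countable w).
  pose num (v : V) := if v.2 is inl n then n else 0.
  pose code (p : IT) : nat + option nat * nat := match p with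
    | inl s => inl (k (pi s) s)
    | inr (t, y) => inr (if `[< core t >] then Some (k (pi t) t) else None, num y)
    end.
  have num_inj y y' : stdc y -> stdc y' -> y.1 = y'.1 -> num y = num y' -> y = y'.
    by case: y => b ? [n /= ->]; case: y' => b' ? [n' /= ->]; rewrite /num /= => -> ->.
  have same_level t y t' y' : idom (inr (t, y)) -> idom (inr (t', y')) ->
      y.1 = c -> y'.1 = c -> ~ ltW (pi t) (pi t').
    move=> [_ _ [[_ ty] _] _ _] [DWt' swt' _ pt' _] yc y'c tt'.
    rewrite yc in ty; rewrite y'c in pt'; apply: ty.
    case: (wo_total woW (pi t) (pr (pi t'))) => [tp|->//|/swt'.2//].
    exact: (wo_trans wo (eta_mono (DW_down DWt' swt'.1) tp) pt').
  apply: (countable_inj (f := code)).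
  case=> [s|[t y]] [s'|[t' y']] [Dp cp lp] [Dq cq lq] //= [].
    have es : pi s = pi s'.
      move: lp lq; rewrite /= => lp lq; have [Ds _] := Dp; have [Ds' _] := Dq.
      case: (wo_total woW (pi s) (pi s')) => // [/(eta_mono Ds')|/(eta_mono Ds)];
      by rewrite lp lq => /(wo_irr wo).
    by rewrite es => /kI->//; rewrite -es.
  move=> + /num_inj ny; rewrite {}ny//; last by rewrite [y.1]lp.
  have et : pi t = pi t'.
    case: (wo_total woW (pi t) (pi t')) => //.
      by move=> /(same_level _ _ _ _ Dp Dq lp lq).
    by move=> /(same_level _ _ _ _ Dq Dp lq lp).
  have ntt u v : idom (inr (u, v)) -> ~ core u -> u = tt (pi u).
    by move=> [_ _ _ _ [[]|]].
  case: asboolP => [ct|nct]; case: asboolP => [ct'|nct'] //.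
    by rewrite et => -[/kI->//]; rewrite -et.
  by move=> _; rewrite (ntt _ _ Dp nct) (ntt _ _ Dq nct') et.
- move=> /iLv_split[w [Dw below wc [[ec ns]|sww]]].
    apply: (infinite_image_inj (f := inl)) (skel_infinite (w := w)) => [? ? _ _ []//|s Os].
    by split; rewrite /= ?(skel_pi Os)//; [split=> //; left|]; exact: skel_coreE Os.
  apply: (infinite_range (f := fun n => inr (tt w, (c, inl n)))) => [m n []//|n].
  split=> //; last by exists n.
  by apply: dom_tt (below _ sww.1) wc _ _ => // -[]; exists n.
- move=> /iLv_split[w [Dw below wc [[ec ns]|sww]]] ac Nc.
    have [g [gI hg]] := rest w; exists (inl \o g); split=> [x y [/gI]//|l].
    have [pg ng] := hg l; split; rewrite /= ?pg//; first by split=> //; right.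
    by rewrite /core /= pg.
  exists (fun l => inr (tt w, (c, inr l))); split=> [x y []//|l].
  split=> //; last by case.
  by apply: dom_tt (below _ sww.1) wc _ _.
Qed.

End Insertion.

End Skeleton.

(** * The induction on the right end of the interval *)

Section Universal.
Context (L J : Type) (l0 : L) (lt : J -> J -> Prop) (wo : wellorder lt) (N : set J).

(** The constructions change the carrier, so it is left free here and normalised to [J * (nat + L)]
    at the end of each induction step. *)
Definition realizable (Lv : set J) (a : J) : Prop :=
  exists (T : Type) (lev : T -> J) (core D : set T) (le : T -> T -> Prop),
    graded_poset lt lev core D le Lv /\ wide L lt N lev core D Lv a.

Lemma universal_of_realizable (a b : J) : ~ lt b a ->
  realizable (interval lt a b) a -> universal L lt N a b.
Proof.
move=> ba [T [lev [core [D [le [gp wd]]]]]].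
exact: (universal_of_wide wo ba gp wd).
Qed.

Lemma realizable_cap (Lv : set J) (a b : J) : (forall x, Lv x -> lt x b) ->
  ~ N b -> realizable Lv a -> realizable [set x | Lv x \/ x = b] a.
Proof.
move=> Lvb Nb [T [lev [core [D [le [gp wd]]]]]].
do 5![eexists]; split; first exact: (cap_graded wo gp wd Lvb).
exact: (cap_wide wo gp wd Lvb Nb).
Qed.

Context (W : Type) (ltW : W -> W -> Prop) (oW : ordertype_omega2 ltW) (T : Type)
  (pi : T -> W) (leT : T -> T -> Prop) (i : T -> T -> set T) (O : W -> set T).
Hypothesis sk : skeleton ltW pi leT i O.
Hypothesis rest : forall w, exists g : L -> T, injective g /\
  forall l, pi (g l) = w /\ ~ O w (g l).
Let woW : wellorder ltW. Proof. by case: oW. Qed.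

Lemma realizable_ladder (a : J) (DW : set W) (eta : W -> J) :
  (forall v w, DW w -> ltW v w -> DW v) ->
  (forall w, ~ lt (eta w) a) ->
  (forall v w, DW w -> ltW v w -> lt (eta v) (eta w)) ->
  (forall w x, DW w -> ~ lt x a -> (forall v, ~ succ_of ltW v w) ->
    (forall v, ltW v w -> lt (eta v) x) -> ~ lt x (eta w)) ->
  (forall v w, DW w -> succ_of ltW v w -> universal L lt N (eta v) (eta w)) ->
  realizable [set x | ~ lt x a /\ exists2 w, DW w & ~ lt (eta w) x] a.
Proof.
move=> down ge mono cont univ.
have /choice[pr prP] : forall w, exists v, forall u, succ_of ltW u w ->
    succ_of ltW v w.
  move=> w; have [[v vw]|n] := pselect (exists v, succ_of ltW v w); first by exists v.
  by exists w => u uw; case: n; exists u.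
have /choice[e eP] : forall t, exists e : nat -> T, succ_of ltW (pr (pi t)) (pi t) ->
    injective e /\ forall n, O (pr (pi t)) (e n) /\ leT (e n) t.
  move=> t; have [[pt _]|n] := pselect (succ_of ltW (pr (pi t)) (pi t)).
    by have [e eI eO] := infinite_enum (skel_inf sk pt); exists e.
  by exists (fun=> t) => /n.
have /choice[tt ttP] : forall w, exists t, pi t = w /\ ~ skel_core pi O t.
  move=> w; have [g [_ hg]] := rest w; exists (g l0); have [pg ng] := hg l0.
  by split; rewrite /skel_core /= ?pg.
have /choice[S SP] : forall w, exists S, DW w -> succ_of ltW (pr w) w ->
    graded_poset lt fst (@std_core L J) (std_dom lt N (eta (pr w)) (eta w)) S
      (interval lt (eta (pr w)) (eta w)).
  move=> w; have [[Dw sw]|n] := pselect (DW w /\ succ_of ltW (pr w) w).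
    by have [S SP] := univ _ _ Dw sw; exists S.
  by exists (fun _ _ => False) => Dw sw; case: n.
have prP' v w : succ_of ltW v w -> succ_of ltW (pr w) w by exact: prP.
do 5![eexists]; split.
  exact: (insertion_graded woW sk wo down ge mono cont prP' eP ttP SP).
exact: (insertion_wide woW sk rest wo N down mono cont prP' ttP).
Qed.

Hypothesis le2 : forall b, le_aleph2 {x | lt x b}.
Hypothesis hN : forall b, N b ->
  exists C : set J, cofinal_below lt b C /\ le_aleph1 {x : J | C x}.

Theorem universal_exists (a b : J) : lt a b -> universal L lt N a b.
Proof.
elim/(well_founded_ind (wo_ind wo)): b a => b IH a ab.
have [eta [eab emono econt esucc ecof]] := ladder_exists oW wo ab (@le2 b) (@hN b).
have ea w : ~ lt (eta w) a by case: (eab w).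
have eb w : ~ lt b (eta w) by case: (eab w).
apply: (universal_of_realizable (wo_asym wo ab)).
have [reach|nreach] := pselect (exists w, eta w = b).
  (* From [th] on the ladder is constantly [b]; it is strictly increasing only up to [th], where it
     is cut off. *)
  have [th [ethb thmin]] := wo_least woW reach.
  have mono v w : ~ ltW th w -> ltW v w -> lt (eta v) (eta w).
    move=> wth vw; case: (emono _ _ vw) => // ewb; rewrite ewb.
    have vth : ltW v th by exact: (lt_nlt_trans woW vw wth).
    by case: (nlt_eqVlt wo (@eb v)) => // evb; case: (thmin v evb).
  rewrite (_ : interval lt a b =
      [set x | ~ lt x a /\ exists2 w, ~ ltW th w & ~ lt (eta w) x]); last first.
    apply/seteqP; split=> x [xa xb]; split=> //.
      by exists th; [exact: (wo_irr woW)|rewrite ethb].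
    by case: xb => w _ wx bx; apply: wx; exact: (nlt_lt_trans wo (@eb w) bx).
  apply: realizable_ladder => //.
  - by move=> v w wth vw thv; apply: wth; exact: (wo_trans woW thv vw).
  - by move=> w x _; exact: econt.
  - move=> v w wth vw; have := mono _ _ wth vw.1 => evw.
    (* A step ending in [b] escapes the induction hypothesis, but then [b] is the successor of
       [eta v]. *)
    have [ewb|newb] := pselect (eta w = b).
      have [w0 [_ min0]] := wo_least woW (P := fun=> True) (ex_intro _ th I).
      have [w1 [w01 min1]] := wo_least woW (omega2_nomax oW w0).
      have s01 : succ_of ltW w0 w1 by split=> // u /min1.
      rewrite ewb; apply: (universal_succ woW sk rest wo N _ s01).
        by move=> u; exact: min0.
      by apply: (esucc v w) => //; rewrite -ewb.
    by apply: IH => //; case: (nlt_eqVlt wo (@eb w)).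
(* The ladder is cofinal in [b] without reaching it; since [N b] fails, [b] can be added as a level
   of core points only. *)
case: ecof => [//|[Nb cof]].
have eltb w : lt (eta w) b.
  by case: (nlt_eqVlt wo (@eb w)) => // e; case: nreach; exists w.
have mono v w : ltW v w -> lt (eta v) (eta w).
  by move=> vw; case: (emono _ _ vw) => // e; case: nreach; exists w.
rewrite (_ : interval lt a b = [set x |
    [set x | ~ lt x a /\ exists2 w, setT w & ~ lt (eta w) x] x \/ x = b]); last first.
  apply/seteqP; split=> x.
    move=> [xa bx]; case: (nlt_eqVlt wo bx) => [|/cof[w xw]]; [by right|left].
    by split=> //; exists w => //; exact: (wo_asym wo xw).
  case=> [[xa [w _ wx]]|->].
    by split=> // bx; exact: wx (wo_trans wo (eltb w) bx).
  by split; [exact: (wo_asym wo ab)|exact: (wo_irr wo)].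
apply: realizable_cap => //.
  by move=> x [_ [w _ wx]]; exact: (nlt_lt_trans wo wx (eltb w)).
apply: realizable_ladder => //.
- by move=> v w _; exact: mono.
- by move=> w x _; exact: econt.
- by move=> v w _ [vw _]; apply: IH => //; exact: mono.
Qed.

End Universal.

(** * Throwing away maximal points *)

Section Thinning.
Context (L I : Type) (ltI : I -> I -> Prop) (woI : wellorder ltI)
  (N : set (option I)) (R : I -> Type) (j : forall a, R a -> L).
Hypothesis jI : forall a, injective (@j a).
Hypothesis RN : forall a, R a -> N (Some a).
Hypothesis univ : forall i0, (forall i, ~ ltI i i0) ->
  universal L (lt_top ltI) N (Some i0) None.

Let FT := {a : I & (nat + R a)%type}.
Let phi (x : FT) : option I * (nat + L) :=
  (Some (projT1 x), match projT2 x with inl n => inl n | inr k => inr (j k) end).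

Let phi_inj : injective phi.
Proof.
move=> [a [n|k]] [b [m|l]] [] eab; subst b => //; first by move=> ->.
by move=> /jI->.
Qed.

(** The bottom level of [S] has no points outside the core, so [phi] sends points [inr k] of level
    [i0] outside the domain. The disjunct [x = y] adds them as points comparable only to
    themselves. *)
Let graded_of (S : option I * (nat + L) -> option I * (nat + L) -> Prop) i0 :
  (forall i, ~ ltI i i0) ->
  graded_poset (lt_top ltI) fst (@std_core L (option I))
    (std_dom (lt_top ltI) N (Some i0) None) S
    (interval (lt_top ltI) (Some i0) None) ->
  graded_poset ltI (@projT1 I (fun a => nat + R a)%type) setT setT
    (fun x y => x = y \/ S (phi x) (phi y)) setT.
Proof.
move=> min0 gp; have wo := wellorder_top woI.
have i0b a b : ltI b a -> ltI i0 a.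
  by move=> ba; exact: (nlt_lt_trans woI (@min0 b) ba).
have inter a : interval (lt_top ltI) (Some i0) None (Some a).
  by split=> //; exact: min0.
have phi_dom x : (exists b, ltI b (projT1 x)) ->
    std_dom (lt_top ltI) N (Some i0) None (phi x).
  move=> [b bx]; split; first exact: inter.
  case: x bx => a [n|k] /= ba ncore; first by case: ncore; exists n.
  by split; [exact: i0b ba|exact: RN].
have core_phi b v y : v.1 = Some b -> ltI b (projT1 y) -> S v (phi y) ->
    exists n, v = (Some b, inl n).
  move=> vb bx vx; case: (gp_below gp vx) => [e|[[n vn] _]].
    by move: vb bx; rewrite e => -[->] /(wo_irr woI).
  by exists n; case: v vb vn {vx} => ? ? /= -> ->.
split=> //.
- by move=> x _; left.
- move=> x y z [->//|xy] [<-|yz]; first by right.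
  by right; exact: (gp_trans gp xy yz).
- move=> x y [|/(gp_below gp)[/phi_inj|[_]]]; by [left|right].
- move=> t b _ _ bt.
  have Dt : std_dom (lt_top ltI) N (Some i0) None (phi t) by apply: phi_dom; exists b.
  pose f (v : option I * (nat + L)) : FT :=
    existT _ b (inl (if v.2 is inl n then n else 0)).
  apply: (infinite_image_inj (f := f)) (gp_inf gp Dt (inter b) bt).
    move=> v v' [/core_phi H /H{}H] [/core_phi H' /H'{}H'].
    by have [n ->] := H bt; have [n' ->] := H' bt => /= -[->].
  move=> v [vb vt]; have [n ev] := core_phi _ _ _ vb bt vt.
  by split=> //; right; rewrite ev in vt *.
- move=> x y _ _; have [<-{y}|nxy] := pselect (x = y).
    exists [set x]; split=> [|_ ->|u ux _]; first exact: finite_set1.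
      by split; left.
    by exists x.
  (* A point mapped outside the domain of [S] is comparable only to itself, so the empty set serves
     as the meet. *)
  have [[Dx Dy]|nD] := pselect (std_dom (lt_top ltI) N (Some i0) None (phi x) /\
      std_dom (lt_top ltI) N (Some i0) None (phi y)); last first.
    have dom u v : S (phi u) (phi v) ->
        std_dom (lt_top ltI) N (Some i0) None (phi u) /\
        std_dom (lt_top ltI) N (Some i0) None (phi v) by exact: gp_dom gp _ _.
    exists set0; split=> // u ux uy; exfalso.
    case: ux uy => [->|ux] [e|uy].
    - exact: nxy.
    - by apply: nD; exact: dom.
    - by apply: nD; rewrite -e; case: (dom _ _ ux).
    - by apply: nD; split; [case: (dom _ _ ux)|case: (dom _ _ uy)].
  have [F [finF Fxy FU]] := gp_meet gp Dx Dy.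
  have /choice[psi hpsi] : forall v, exists z : FT, F v -> phi z = v.
    move=> v; have [Fv|nFv] := pselect (F v); last by exists x.
    have [vx _] := Fxy v Fv; case: (gp_below gp vx) => [->|[[n vn]]]; first by exists x.
    case ev: v.1 => [b|//] _; exists (existT _ b (inl n)) => _.
    by case: v ev vn {Fv vx} => ? ? /= -> ->.
  apply: (graded_finite_image finF (f := psi)) => [v Fv|u ux uy].
    by rewrite hpsi//; have [vx vy] := Fxy v Fv; split; right.
  have S_of z : std_dom (lt_top ltI) N (Some i0) None (phi z) ->
      u = z \/ S (phi u) (phi z) -> S (phi u) (phi z).
    by move=> Dz [->|//]; exact: (gp_refl gp).
  have [v Fv uv] := FU _ (S_of _ Dx ux) (S_of _ Dy uy).
  by exists v => //; right; rewrite hpsi.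
Qed.

Lemma graded_thinning : exists le, graded_poset ltI
  (@projT1 I (fun a => nat + R a)%type) setT setT le setT.
Proof.
have [[i1 _]|ne] := pselect (exists i : I, True).
  have [i0 [_ min0]] := wo_least woI (P := fun=> True) (ex_intro _ i1 Logic.I).
  have {}min0 i : ~ ltI i i0 by exact: min0.
  have [S gp] := univ min0.
  by exists (fun x y => x = y \/ S (phi x) (phi y)); exact: graded_of gp.
have e (x : FT) : False by apply: ne; exists (projT1 x).
by exists (fun _ _ => False); split=> [? ?|?|?|? ?|?|?|?] //; case: (e _).
Qed.

End Thinning.

Theorem theorem2p5
  (L : Type)                           (* lambda = |L| *)
  (hreg : regular_card L)
  (hge : ~ le_aleph1 L)                (* lambda >= omega_2 *)
  (hcont : equipotent (nat -> bool) L) (* 2^omega = lambda *)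
  (I : Type) (ltI : I -> I -> Prop)    (* the ordinal eta *)
  (hI : wellorder ltI)
  (heta : le_aleph2 I)                 (* eta < omega_3 *)
  (hskel : has_const_omega2_skeleton L)
  (K : I -> Type)                      (* f = <kappa_a : a < eta> *)
  (hKinf : forall a, infinite_type (K a))
  (hKle : forall a, inj_le (K a) L)
  (hKcf : forall a, cf_omega2 ltI a -> equipotent (K a) nat) :
  exists X : topologicalType, LCS_space X /\ @cardinal_sequence_is X I ltI K.
Proof.
have [W [ltW [T [pi [leT [i [O [oW [eL sk]]]]]]]]] := hskel.
have rest w : exists g : L -> T, injective g /\ forall l, pi (g l) = w /\ ~ O w (g l).
  (* The level has the size of the continuum and [O w] is countable. *)
  exact: (continuum_diff hcont (eL w) (skel_countable sk w)).
have l0 : L by case: (cid hcont) => f _; exact: f (fun=> true).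
(* [None] stays out of [N]: it is only the right end of the interval, and thinning discards its
   level. *)
pose N := [set x : option I | if x is Some a then ~ cf_omega2 ltI a else False].
have le2 b : le_aleph2 {x | lt_top ltI x b}.
  have /choice[f hf] : forall x : {x | lt_top ltI x b}, exists a, sval x = Some a.
    by case=> -[a|] /=; [exists a|case: b].
  by apply: (le_aleph2_inj (f := f)) => // x y exy; apply: sig_inj; rewrite !hf exy.
have hN b : N b -> exists C : set (option I),
    cofinal_below (lt_top ltI) b C /\ le_aleph1 {x : option I | C x}.
  case: b => [a /= na|//].
  (* The segment below [a] is itself cofinal of size at most aleph_2, so if the cofinality is not
     omega_2 there is a cofinal set of size at most aleph_1. *)
  have [C [[Ca Ccof] C1]] : exists C, cofinal_below ltI a C /\ le_aleph1 {x : I | C x}.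
    apply: contrapT => nC; apply: na; split; last first.
      by move=> C Ca C1; apply: nC; exists C.
    exists [set c | ltI c a]; split; first by split=> // b ba; exists b => //; left.
    by apply: (le_aleph2_inj (f := sval)) heta => x y; exact: sig_inj.
  exists (Some @` C); split.
    split=> [_ [c Cc <-]|[b|//] /Ccof[c Cc bc]]; first exact: Ca.
    by exists (Some c); [exists c|case: bc => [->|]; [left|right]].
  have /choice[f hf] : forall x : {x | (Some @` C) x}, exists c : {c | C c},
      sval x = Some (sval c).
    by move=> [x [c Cc e]]; exists (exist _ c Cc) => /=; rewrite e.
  apply: (le_aleph1_inj (f := f)) C1 => x y exy.
  by apply: sig_inj; rewrite !hf exy.
(* At cofinality omega_2 this is empty and level [a] keeps its countable core alone; elsewhere it is
   a copy of [K a], which absorbs the core. *)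
pose R a := {k : K a | ~ cf_omega2 ltI a}.
pose j0 a : K a -> L := sval (cid (hKle a)).
have j0I a : injective (j0 a) by exact: (svalP (cid (hKle a))).
have [|a|i0 min0|le gp] := @graded_thinning L I ltI hI N R (fun a k => j0 a (sval k)).
- by move=> a x y /j0I/sig_inj.
- by case.
- exact: (universal_exists l0 (wellorder_top hI) oW sk rest le2 hN).
exists (poset_space le); split; first exact: (poset_space_LCS hI gp).
apply: (poset_space_sequence hI gp) => a.
pose fiber := {x : {a : I & (nat + R a)%type} | projT1 x = a}.
pose inc (s : nat + R a) : fiber := exist _ (existT _ a s) erefl.
pose cast (x : fiber) : nat + R a :=
  eq_rect _ (fun b => (nat + R b)%type) (projT2 (sval x)) a (proj2_sig x).
have castK : cancel cast inc by move=> [[b s] /= e]; subst b.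
have incK : cancel inc cast by [].
have [g1 g1I] : exists g : nat + R a -> K a, injective g.
  have [cfa|ncfa] := pselect (cf_omega2 ltI a).
    have [h [h' hK h'K]] := hKcf a cfa.
    exists (fun s => match s with inl n => h' n | inr k => sval k end).
    move=> [n|[k //]] [m|[l //]].
    by move=> /(can_inj h'K)->.
  have [h hinj] := sum_nat_inj (@hKinf a).
  exists (fun s => h (match s with inl n => inl n | inr k => inr (sval k) end)).
  by move=> [n|k] [m|l] /hinj // [] => [->|/sig_inj->].
have [g2 g2I] : exists g : K a -> nat + R a, injective g.
  have [cfa|ncfa] := pselect (cf_omega2 ltI a).
    have [h [h' hK h'K]] := hKcf a cfa.
    by exists (inl \o h) => x y [/(can_inj hK)].
  by exists (fun k => inr (exist _ k ncfa)) => x y [].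
apply: (equipotent_antisym (f := g1 \o cast) (g := inc \o g2)).
- by move=> x y /g1I/(can_inj castK).
- by move=> x y /(can_inj incK)/g2I.
Qed.
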